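(* Let $\mathcal{A}$ be a generic arrangement in $\mathbb{K}^\ell$ consisting of $\ell+1$ hyperplanes. Then $$\Psi(\mathcal{A};x,t)=(1+(\ell-1)x)-t\Big(x+\Big(\binom{\ell+1}{2}-1\Big)x^2\Big)+\sum_{i=2}^{\ell}(-1)^i\binom{\ell+1}{i+1}x^{i+1}t^i.$$
   Context: $\mathbb{K}$ a field, $S=\mathbb{K}[x_1,\dots,x_\ell]$. An arrangement of $\ell+1$ linear hyperplanes in $\mathbb{K}^\ell$ is generic if any $\ell$ of their defining linear forms are linearly independent. For an arrangement $\mathcal{A}$ with defining forms $\alpha_H$: $\operatorname{Der}^pS=\wedge^p_S\operatorname{Der}S$ (alternating multiderivations), graded with $\deg\partial_{x_i}=0$; $D^p(\mathcal{A})=\{\theta\in\operatorname{Der}^pS:\theta(\alpha_H,f_2,\dots,f_p)\in\alpha_HS\ \forall H\in\mathcal{A},f_j\in S\}$, $D^0=S$; $\operatorname{Hilb}(M;x)=\sum_j\dim M_jx^j$; $\Psi(\mathcal{A};x,t)=\sum_{p=0}^\ell\operatorname{Hilb}(D^p(\mathcal{A});x)(t(x-1)-1)^p$. *)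

(* Defs.v *)
From Stdlib Require Import ClassicalEpsilon.
From HB Require Import structures.
From mathcomp Require Import all_boot all_order all_algebra.
From mathcomp Require Import mpoly.
Set Implicit Arguments.
Unset Strict Implicit.
Unset Printing Implicit Defensive.
Import GRing.Theory.
Local Open Scope ring_scope.

(** A central arrangement of [n] hyperplanes in [K^l] is given by the matrix
    [A : 'M[K]_(n, l)] whose [i]-th row holds the coefficients of a defining
    linear form of the [i]-th hyperplane. *)

Section Arrangements.
Variables (K : fieldType) (n l : nat).
Implicit Type A : 'M[K]_(n, l).

Definition hyperplane A (i : 'I_n) : pred 'cV[K]_l :=
  [pred v | row i A *m v == 0].

Definition is_arrangement A : Prop :=
  (forall i, row i A != 0) /\
  (forall i j, hyperplane A i =1 hyperplane A j -> i = j).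

Definition any_l_independent A : Prop :=
  forall f : 'I_l -> 'I_n, injective f -> row_free (rowsub f A).

Definition linform A (i : 'I_n) : {mpoly K[l]} := \sum_(j < l) A i j *: 'X_j.

End Arrangements.

Definition generic_arrangement (K : fieldType) (l : nat)
    (A : 'M[K]_(l.+1, l)) : Prop :=
  is_arrangement A /\ any_l_independent A.

Section Multiderivations.
Variables (K : fieldType) (l p : nat).
Local Notation S := {mpoly K[l]}.
Implicit Types (theta : {ffun 'I_p -> S} -> S) (f : {ffun 'I_p -> S}).

Definition subst_at f (i : 'I_p) (g : S) : {ffun 'I_p -> S} :=
  [ffun k => if k == i then g else f k].

Definition is_derivation (d : S -> S) : Prop :=
  (forall (c : K) g h, d (c *: g + h) = c *: d g + d h) /\
  (forall g h, d (g * h) = g * d h + h * d g).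

(** [Der^p S], as the alternating [p]-fold multiderivations of [S].  For
    [p = 0] these are the maps out of the one-point type, i.e. [S] itself. *)
Definition is_multider theta : Prop :=
  (forall f i, is_derivation (fun g => theta (subst_at f i g))) /\
  (forall f i j, i != j -> f i = f j -> theta f = 0).

(** [theta] lies in [D^p(A)].  The condition [k = 0 :> nat] singles out the
    first argument; for [p = 0] there is none, so that [D^0(A) = S]. *)
Definition log_multider n (A : 'M[K]_(n, l)) theta : Prop :=
  is_multider theta /\
  (forall (H : 'I_n) f (k : 'I_p),
     k = 0%N :> nat -> f k = linform A H ->
     exists q : S, theta f = linform A H * q).

(** The coefficients of [theta] on the [d/dx_{i_1} /\ ... /\ d/dx_{i_p}] are
    the values [theta (x_{i_1}, ..., x_{i_p})], so with [deg d/dx_i = 0] the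
    degree of [theta] is the polynomial degree of these values. *)
Definition multider_homog (j : nat) theta : Prop :=
  forall v : {ffun 'I_p -> 'I_l}, theta [ffun k => 'X_(v k)] \is j.-homog.

End Multiderivations.

Section Dimension.
Variables (K : fieldType) (X : Type) (V : lmodType K).

(** The predicate [M] on functions [X -> V] (a subspace for the pointwise
    operations) has a basis [b] with [d] elements. *)
Definition has_dim (M : (X -> V) -> Prop) (d : nat) : Prop :=
  exists b : 'I_d -> X -> V,
    [/\ forall i, M (b i),
        forall c : 'I_d -> K,
          (forall x, \sum_(i < d) c i *: b i x = 0) -> forall i, c i = 0 &
        forall u, M u ->
          exists c : 'I_d -> K, forall x, u x = \sum_(i < d) c i *: b i x].

(** Unspecified when [M] is not finite-dimensional. *)
Definition dimension (M : (X -> V) -> Prop) : nat :=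
  epsilon (inhabits 0%N) (has_dim M).

End Dimension.

(** A formal power series in [x] over [R] is its sequence of coefficients. *)
Section PowerSeries.
Variable R : nzRingType.

Definition fps_of_poly (P : {poly R}) : nat -> R := fun n => P`_n.

Definition fps_mul (F G : nat -> R) : nat -> R :=
  fun n => \sum_(i < n.+1) F i * G (n - i)%N.

End PowerSeries.

(** Series in [x] with coefficients in [int[t]]: in [{poly {poly int}}] the
    outer indeterminate is [x] and the inner one is [t]. *)
Definition xvar : {poly {poly int}} := 'X.
Definition tvar : {poly {poly int}} := ('X)%:P.

Definition Hilb (K : fieldType) n l (A : 'M[K]_(n, l)) (p : nat) :
    nat -> {poly int} :=
  fun j =>
    (dimension (fun theta : {ffun 'I_p -> {mpoly K[l]}} -> {mpoly K[l]} =>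
       log_multider A theta /\ multider_homog j theta))%:R.

Definition Psi (K : fieldType) n l (A : 'M[K]_(n, l)) : nat -> {poly int} :=
  fun m => \sum_(p < l.+1)
    fps_mul (Hilb A p) (fps_of_poly ((tvar * (xvar - 1) - 1) ^+ p)) m.

(* Main.v *)
Require Import Defs.
From HB Require Import structures.
From Stdlib Require Import ClassicalEpsilon FunctionalExtensionality.
From mathcomp Require Import all_boot all_fingroup all_algebra.
From mathcomp Require Import mpoly.
From mathcomp Require Import ring.

(** After a linear change of coordinates the forms are [x_1, ..., x_l] and
    [beta = x_1 + ... + x_l].  Contraction with [beta] sends [theta] in [D^p] to
    [theta(beta, ...) / beta], which lies in the space [Z_{p-1}] of those
    multiderivations tangent to the coordinate hyperplanes that contraction with
    [beta] kills; the kernel is [Z_p], and the exterior product with the Euler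
    derivation [E] splits the map, so that [D^p = Z_p + E /\ Z_{p-1}].

    Tangency to the coordinate hyperplanes means that only the terms
    [x^u d_J] with [J] inside the support of [u] occur, and contraction with
    [beta] preserves [u].  With [i0] a chosen index in the support of [u],
    the elements [x^u /\_{i in J} (d_i - d_i0)], with [J] inside the support of
    [u] and [i0] not in [J], form a basis of [Z_p].  Counting gives
    [Z_p + Z_{p-1} = C(l, p) x^p (1 - x)^{-l} + delta_{p,1}] for the Hilbert
    series, whence [(1 + w) Psi = (1 + x w) (w + (1 + x w)^l (1 - x)^{-l})] for
    [w = t (x - 1) - 1]; here [1 + x w = (1 - x) (1 - t x)]. *)

Set Implicit Arguments.
Unset Strict Implicit.
Unset Printing Implicit Defensive.
Import GRing.Theory.
Local Open Scope ring_scope.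

(** * Uniqueness of dimension, and bases indexed by finite types *)

Section DimensionTheory.
Variables (K : fieldType) (X : Type) (V : lmodType K).
Implicit Type M : (X -> V) -> Prop.

(** The coefficients of [b] in terms of [b'] form a [d] by [e] matrix. A row vector killed by it is
    a linear relation among the [b i], so its rank is [d]. *)
Lemma has_dim_leq M d e : has_dim M d -> has_dim M e -> (d <= e)%N.
Proof.
move=> [b [Mb freeb _]] [b' [Mb' _ spanb']].
have /fin_all_exists [P PE] i := spanb' (b i) (Mb i).
pose A := \matrix_(i < d, k < e) P i k.
suff: row_free A by rewrite /row_free => /eqP <-; exact: rank_leq_col.
apply: inj_row_free => v vA0; apply/rowP => i; rewrite mxE.
apply: (freeb (v 0)) => x.
under eq_bigr do rewrite PE scaler_sumr.
rewrite exchange_big big1 // => k _ /=.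
under eq_bigr do rewrite scalerA.
rewrite -scaler_suml; move/rowP/(_ k): vA0; rewrite !mxE => vk.
rewrite (_ : \sum_i _ = 0) ?scale0r // -[RHS]vk.
by apply: eq_bigr => i' _; rewrite mxE.
Qed.

Lemma dimension_eq M d : has_dim M d -> dimension M = d.
Proof.
move=> Md; have Me : has_dim M (dimension M) by apply: epsilon_spec; exists d.
by apply/eqP; rewrite eqn_leq !(has_dim_leq Md Me, has_dim_leq Me Md).
Qed.

Lemma has_dim_card (I : finType) (P : {pred I}) (b : I -> X -> V) M :
  (forall i, i \in P -> M (b i)) ->
  (forall c : I -> K, (forall x, \sum_(i in P) c i *: b i x = 0) ->
     forall i, i \in P -> c i = 0) ->
  (forall u, M u ->
     exists c : I -> K, forall x, u x = \sum_(i in P) c i *: b i x) ->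
  has_dim M #|P|.
Proof.
move=> Mb freeb spanb; exists (fun k => b (enum_val k)); split.
- by move=> k; apply/Mb/enum_valP.
- move=> c c0 k.
  have Pk := enum_valP k.
  pose c' i := c (enum_rank_in Pk i).
  rewrite -[k](enum_valK_in Pk); apply: (freeb c') => [x|]; last exact: Pk.
  rewrite big_enum_val -[RHS](c0 x); apply: eq_bigr => i _.
  by rewrite /c' enum_valK_in.
- move=> u /spanb [c cE]; exists (fun k => c (enum_val k)) => x.
  by rewrite cE big_enum_val.
Qed.

(** The two families are glued along the disjoint sum [I + I], since [P1] and [P2] may overlap. *)
Lemma has_dim_card_add (I : finType) (P1 P2 : {pred I}) (b1 b2 : I -> X -> V) M :
  (forall i, i \in P1 -> M (b1 i)) -> (forall i, i \in P2 -> M (b2 i)) ->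
  (forall c1 c2 : I -> K,
     (forall x, \sum_(i in P1) c1 i *: b1 i x +
                \sum_(i in P2) c2 i *: b2 i x = 0) ->
     {in P1, forall i, c1 i = 0} /\ {in P2, forall i, c2 i = 0}) ->
  (forall u, M u -> exists c1 c2 : I -> K, forall x,
     u x = \sum_(i in P1) c1 i *: b1 i x + \sum_(i in P2) c2 i *: b2 i x) ->
  has_dim M (#|P1| + #|P2|).
Proof.
move=> M1 M2 freeb spanb.
pose P : {pred I + I} := fun x => match x with
  | inl y => y \in P1 | inr y => y \in P2 end.
have -> : (#|P1| + #|P2|)%N = #|P| by rewrite -!sum1_card big_sumType.
apply: (@has_dim_card _ _ (fun x => match x with inl y => b1 y | inr y => b2 y end)).
- by case=> y; [apply: M1|apply: M2].
- move=> c c0; have [|c1 c2] := freeb (c \o inl) (c \o inr).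
    by move=> x; rewrite -[RHS](c0 x) big_sumType.
  by case=> y; [apply: c1|apply: c2].
- move=> u /spanb [c1 [c2 cE]].
  exists (fun x => match x with inl y => c1 y | inr y => c2 y end) => x.
  by rewrite cE big_sumType.
Qed.
End DimensionTheory.

(** * Derivations of the polynomial ring *)

Section Derivations.
Variables (K : fieldType) (l : nat).
Local Notation S := {mpoly K[l]}.
Variables (d : S -> S) (der : is_derivation d).

Lemma derivationD g h : d (g + h) = d g + d h.
Proof. by have [lin _] := der; rewrite -[g]scale1r lin !scale1r. Qed.

Lemma derivation0 : d 0 = 0.
Proof. by apply: (addrI (d 0)); rewrite -derivationD !addr0. Qed.

Lemma derivationZ c g : d (c *: g) = c *: d g.
Proof. by have [lin _] := der; rewrite -[_ *: g]addr0 lin derivation0 addr0. Qed.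

Lemma derivation_sum I (r : seq I) (P : pred I) (F : I -> S) :
  d (\sum_(i <- r | P i) F i) = \sum_(i <- r | P i) d (F i).
Proof. exact: (big_morph d derivationD derivation0). Qed.

Lemma derivation1 : d 1 = 0.
Proof.
have [_ /(_ 1 1)] := der; rewrite !mul1r => /(congr1 (+%R^~ (- d 1))).
by rewrite subrr addrK.
Qed.

(** By the Leibniz rule vanishing passes from variables to monomials, then by linearity to all
    polynomials. *)
Lemma derivation_eq0 : (forall i, d 'X_i = 0) -> forall g, d g = 0.
Proof.
have [_ leib] := der; move=> dX0 g; rewrite [g]mpolyE derivation_sum.
rewrite big1 // => m _; rewrite derivationZ mpolyXE_id.
suff ->: d (\prod_(i < l) 'X_i ^+ m i) = 0 by rewrite scaler0.
elim/big_ind: _ => [|x y x0 y0|i _]; first exact: derivation1.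
  by rewrite leib x0 y0 !mulr0 addr0.
elim: (m i) => [|k IH]; first by rewrite expr0 derivation1.
by rewrite exprS leib IH dX0 !mulr0 addr0.
Qed.

End Derivations.

Section Combination.
Variables (K : fieldType) (l : nat).
Local Notation S := {mpoly K[l]}.

Lemma derivation_comb (d1 d2 : S -> S) (s1 s2 : S) :
  is_derivation d1 -> is_derivation d2 ->
  is_derivation (fun g => s1 * d1 g + s2 * d2 g).
Proof.
move=> [lin1 leib1] [lin2 leib2]; split=> [c g h|g h].
  by rewrite lin1 lin2 !mulrDr -!scalerAr scalerDr addrACA.
by rewrite leib1 leib2; ring.
Qed.

Lemma mderiv_derivation i : is_derivation (@mderiv l K i).
Proof.
split=> [c g h|g h]; first exact: mderiv_is_linear.
by rewrite mderivM; ring.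
Qed.

Definition euler (g : S) : S := \sum_i 'X_i * mderiv i g.

Lemma euler_derivation : is_derivation euler.
Proof.
split=> [c g h|g h]; rewrite /euler.
  rewrite scaler_sumr -big_split; apply: eq_bigr => i _ /=.
  by rewrite mderiv_is_linear mulrDr -scalerAr.
rewrite !mulr_sumr -big_split; apply: eq_bigr => i _ /=.
by rewrite mderivM; ring.
Qed.

Lemma mderivXU (i j : 'I_l) : mderiv i 'X_j = (i == j)%:R :> S.
Proof.
rewrite mderivX mnm1E eq_sym; case: eqVneq => [->|_]; last by rewrite scale0r.
suff ->: (U_(j) - U_(j))%MM = 0%MM :> 'X_{1..l} by rewrite mpolyX0 scale1r.
by apply/mnmP => k; rewrite mnmBE mnm0E subnn.
Qed.

Lemma eulerX i : euler 'X_i = 'X_i.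
Proof.
rewrite /euler (bigD1 i) //= mderivXU eqxx mulr1 big1 ?addr0 // => j ne.
by rewrite mderivXU (negPf ne) mulr0.
Qed.

End Combination.

(** * Alternating multiderivations *)

Section MultiderTheory.
Variables (K : fieldType) (l p : nat).
Local Notation S := {mpoly K[l]}.
Implicit Types (theta : {ffun 'I_p -> S} -> S) (f : {ffun 'I_p -> S}).

Lemma subst_at_id f i : subst_at f i (f i) = f.
Proof. by apply/ffunP => k; rewrite ffunE; case: eqP => // ->. Qed.

Lemma subst_atC f i j g h : i != j ->
  subst_at (subst_at f i g) j h = subst_at (subst_at f j h) i g.
Proof.
move=> ne; apply/ffunP => k; rewrite !ffunE.
by case: (eqVneq k j) => // ->; rewrite eq_sym (negPf ne).
Qed.

(** Polarisation: the alternating condition with [f i + f j] in both places leaves only the two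
    mixed values, whose sum is therefore zero. *)
Lemma multider_tperm theta f (i j : 'I_p) : is_multider theta -> i != j ->
  theta [ffun k => f (tperm i j k)] = - theta f.
Proof.
move=> [der alt] ne.
pose F a b := theta (subst_at (subst_at f i a) j b).
have FDr a b c : F a (b + c) = F a b + F a c by rewrite /F (derivationD (der _ _)).
have FDl a b c : F (a + b) c = F a c + F b c.
  by rewrite /F !(subst_atC _ _ _ ne) (derivationD (der _ _)).
have F0 a : F a a = 0.
  by apply: (alt _ i j ne); rewrite !ffunE eqxx (negPf ne) eqxx.
have /eqP: F (f i + f j) (f i + f j) = 0 by [].
rewrite FDl !FDr !F0 add0r addr0 addrC addr_eq0 => /eqP FE.
have -> : [ffun k => f (tperm i j k)] = subst_at (subst_at f i (f j)) j (f i).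
  apply/ffunP => k; rewrite !ffunE; case: tpermP => [->|->|/eqP ni /eqP nj].
  - by rewrite (negPf ne) eqxx.
  - by rewrite eqxx.
  - by rewrite (negPf ni) (negPf nj).
rewrite -/(F _ _) FE /F; congr (- theta _).
apply/ffunP => k; rewrite !ffunE.
by case: eqVneq => [->|_] //; case: eqVneq => [->|].
Qed.

Lemma multider_perm theta f (s : {perm 'I_p}) : is_multider theta ->
  theta [ffun k => f (s k)] = (-1) ^+ s * theta f.
Proof.
move=> mtheta; have [ts -> _] := prod_tpermP s.
elim: ts => [|t ts IH].
  rewrite big_nil odd_perm1 expr0 mul1r; congr theta.
  by apply/ffunP => k; rewrite ffunE perm1.
rewrite big_cons odd_mul_tperm; set s' := (\prod_(_ <- ts) _)%g in IH *.
case: (eqVneq t.1 t.2) => [->|ne]; first by rewrite tperm1 mul1g.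
have -> : [ffun k => f ((tperm t.1 t.2 * s')%g k)] =
          [ffun k => [ffun k' => f (s' k')] (tperm t.1 t.2 k)].
  by apply/ffunP => k; rewrite !ffunE permM.
by rewrite multider_tperm // IH signr_addb mulN1r mulNr.
Qed.

(* The arguments are replaced by variables one at a time. *)
Lemma multider_var_ind (P Q : S -> Prop) theta :
    (forall d : S -> S, is_derivation d -> (forall i, Q (d 'X_i)) ->
       forall g, P g -> Q (d g)) ->
    is_multider theta ->
    (forall v : {ffun 'I_p -> 'I_l}, Q (theta [ffun k => 'X_(v k)])) ->
  forall f, (forall k, P (f k)) -> Q (theta f).
Proof.
move=> step [der _] Qvar f Pf.
have: forall m f, (m <= p)%N -> (forall k : 'I_p, (k < m)%N -> P (f k)) ->
    (forall k : 'I_p, (m <= k)%N -> exists i, f k = 'X_i) -> Q (theta f).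
  elim=> [|m IH] {Pf}f lemp Pf Xf.
    have /fin_all_exists [v vE] (k : 'I_p) := Xf k isT.
    have -> : f = [ffun k => 'X_([ffun k => v k] k)].
      by apply/ffunP => k; rewrite !ffunE vE.
    exact: Qvar.
  pose k0 := Ordinal lemp; rewrite -[f](subst_at_id f k0).
  apply: (step (fun g => theta (subst_at f k0 g))); [exact: der| |exact: Pf].
  move=> i; apply: IH => [|k km|k mk]; first exact: ltnW.
    rewrite ffunE; case: eqP => [kk|_]; last by apply/Pf/ltnW.
    by rewrite kk ltnn in km.
  rewrite ffunE; case: eqP => [_|nk]; first by exists i.
  apply: Xf; rewrite ltn_neqAle mk andbT; apply: contra_notN nk => /eqP mk'.
  exact/val_inj.
by move/(_ p f (leqnn p)); apply=> // k pk; have := ltn_ord k; rewrite ltnNge pk.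
Qed.

Lemma multider_eq0 theta : is_multider theta ->
  (forall v : {ffun 'I_p -> 'I_l}, theta [ffun k => 'X_(v k)] = 0) ->
  forall f, theta f = 0.
Proof.
move=> mt v0 f; apply: (@multider_var_ind xpredT (fun x => x = 0) theta) => //.
by move=> d der dX0 g _; apply: derivation_eq0.
Qed.

Lemma is_multider_lin (a b : S) theta1 theta2 :
  is_multider theta1 -> is_multider theta2 ->
  is_multider (fun f => a * theta1 f + b * theta2 f).
Proof.
move=> [der1 alt1] [der2 alt2]; split=> [f i|f i j ne eqf].
  exact: derivation_comb.
by rewrite (alt1 f i j) // (alt2 f i j) // !mulr0 addr0.
Qed.

(** The exterior product of the [d c], scaled by [s]: row [k] involves [f k] alone, and the
    determinant is multilinear and alternating in its rows. *)
Lemma is_multider_det (s : S) (d : 'I_p -> S -> S) :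
  (forall c, is_derivation (d c)) ->
  is_multider (fun f => s * \det (\matrix_(k, c) d c (f k))).
Proof.
move=> der; split=> [f i|f i j ne eqf]; last first.
  rewrite (determinant_alternate ne) ?mulr0 // => c.
  by rewrite !mxE eqf.
pose M g := \matrix_(k, c) d c (subst_at f i g k).
have M' g h : row' i (M g) = row' i (M h).
  by apply/matrixP => k c; rewrite !mxE !ffunE eq_sym (negPf (neq_lift _ _)).
have Mi g : row i (M g) = \row_c d c g.
  by apply/rowP => c; rewrite !mxE ffunE eqxx.
split=> [c g h|g h]; rewrite -!/(M _).
  have -> : \det (M (c *: g + h)) = c%:MP * \det (M g) + 1 * \det (M h).
    apply: (determinant_multilinear (i0 := i)); rewrite ?Mi //.
    apply/rowP => e; have [lin _] := der e.
    by rewrite !mxE lin mul1r mul_mpolyC.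
  by rewrite mul1r mulrDr mul_mpolyC scalerAr.
have -> : \det (M (g * h)) = g * \det (M h) + h * \det (M g).
  apply: (determinant_multilinear (i0 := i)); rewrite ?Mi //.
  by apply/rowP => e; have [_ leib] := der e; rewrite !mxE leib.
by ring.
Qed.

End MultiderTheory.

(** * Listing the elements of a finite set *)

Section SetEnumeration.
Variables (T : finType) (x0 : T).

(** [x0] only fills places past the end of the enumeration; there are none when [#|J| = p]. *)
Definition set_elt p (J : {set T}) (c : 'I_p) : T := nth x0 (enum J) c.

Lemma set_elt_in p (J : {set T}) (c : 'I_p) : #|J| = p -> set_elt J c \in J.
Proof. by move=> Jp; rewrite -mem_enum mem_nth // -cardE Jp. Qed.

Lemma set_elt_inj p (J : {set T}) : #|J| = p -> injective (@set_elt p J).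
Proof.
move=> Jp c d /eqP; rewrite nth_uniq ?enum_uniq -?cardE ?Jp // => /eqP.
exact: val_inj.
Qed.

(** Together with [multider_perm] this reduces the coefficients at injective index tuples to those
    indexed by sets. *)
Lemma inj_set_elt p (v : 'I_p -> T) : injective v ->
  exists s : {perm 'I_p}, forall k, v k = set_elt (v @: setT) (s k).
Proof.
move=> injv; set J := v @: setT.
have Jp : #|J| = p by rewrite card_imset // cardsT card_ord.
have vJ k : v k \in enum J by rewrite mem_enum imset_f.
have ip k : (index (v k) (enum J) < p)%N by rewrite -[X in (_ < X)%N]Jp cardE index_mem.
have injs : injective (fun k => Ordinal (ip k)).
  move=> k k' /(congr1 val) /= /(congr1 (nth x0 (enum J))).
  by rewrite !nth_index // => /injv.
by exists (perm injs) => k; rewrite permE /set_elt /= nth_index.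
Qed.

Lemma set_elt_onto p (J : {set T}) x : #|J| = p -> x \in J ->
  exists k : 'I_p, set_elt J k = x.
Proof.
move=> Jp xJ; have kp : (index x (enum J) < p)%N.
  by rewrite -Jp cardE index_mem mem_enum.
by exists (Ordinal kp); rewrite /set_elt /= nth_index ?mem_enum.
Qed.

End SetEnumeration.

(** * The basis of [Z_p] for the coordinate hyperplanes and [beta] *)

Section CoordinateArrangement.
Variables (K : fieldType) (n : nat).
Local Notation l := n.+2.
Local Notation S := {mpoly K[l]}.
Implicit Types (u : 'X_{1..l}) (J : {set 'I_l}).

Definition beta : S := \sum_i 'X_i.

(** The index [i0]. For [u = 0] it is the default [ord0]; the only [J] inside the empty support is
    then empty, and so avoids it. *)
Definition supp0 u : 'I_l := odflt ord0 [pick i | u i != 0%N].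

Lemma supp0P u i : u i != 0%N -> u (supp0 u) != 0%N.
Proof. by rewrite /supp0; case: pickP => //= -> . Qed.

Local Notation elt J c := (set_elt (ord0 : 'I_l) J c).

(** The derivation [d_i - d_i0], with [i] the element number [c] of [J]. It kills [beta] because all
    partial derivatives of [beta] equal 1. *)
Definition bder p u J (c : 'I_p) (g : S) : S :=
  mderiv (elt J c) g - mderiv (supp0 u) g.

Lemma bder_derivation p u J (c : 'I_p) : is_derivation (bder u J c).
Proof.
have -> : bder u J c = fun g => 1 * mderiv (elt J c) g + (-1) * mderiv (supp0 u) g.
  by apply: functional_extensionality => g; rewrite mul1r mulN1r.
exact: derivation_comb (mderiv_derivation _ _) (mderiv_derivation _ _).
Qed.

Lemma mderiv_beta i : mderiv i beta = 1.
Proof.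
rewrite (derivation_sum (mderiv_derivation K i)) (bigD1 i) //=.
rewrite mderivXU eqxx big1 ?addr0 // => j ne.
by rewrite mderivXU eq_sym (negPf ne).
Qed.

Lemma bder_beta p u J (c : 'I_p) : bder u J c beta = 0.
Proof. by rewrite /bder !mderiv_beta subrr. Qed.

Lemma bderX p u J (c : 'I_p) i :
  bder u J c 'X_i = ((elt J c == i)%:R - (supp0 u == i)%:R)%:MP.
Proof. by rewrite /bder !mderivXU mpolyCB !mpolyC_nat. Qed.

Lemma euler_beta : euler beta = beta.
Proof.
rewrite (derivation_sum (euler_derivation _ _)).
by apply: eq_bigr => i _; rewrite eulerX.
Qed.

Lemma beta_neq0 : beta != 0.
Proof.
apply: contraTneq isT => /(congr1 (mderiv ord0)).
by rewrite mderiv_beta mderiv0 => /eqP; rewrite oner_eq0.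
Qed.

Lemma coefXM_eq0 i (q : S) u : u i = 0%N -> ('X_i * q)@_u = 0.
Proof.
move=> ui; apply: memN_msupp_eq0; rewrite mulrC (perm_mem (msuppMX _ _)).
by apply/negP => /mapP [u' _ uE]; move: ui; rewrite uE mnmDE mnm1E eqxx.
Qed.

Lemma dvdX_mpolyX i u : u i != 0%N -> exists q : S, 'X_[u] = 'X_i * q.
Proof.
move=> ui; exists 'X_[u - U_(i)]; rewrite mulrC -mpolyXD submK //.
by rewrite lep1mP.
Qed.

Section FixedNumberOfArguments.
Variable p : nat.
Implicit Types (theta : {ffun 'I_p -> S} -> S) (f : {ffun 'I_p -> S}).

(* The space [Z_p] in degree [j]. *)
Definition beta_closed (j : nat) theta : Prop :=
  [/\ is_multider theta, multider_homog j theta,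
      forall f (k : 'I_p) i, k = 0%N :> nat -> f k = 'X_i ->
        exists q, theta f = 'X_i * q &
      forall f (k : 'I_p), k = 0%N :> nat -> f k = beta -> theta f = 0].

Lemma beta_closed_lin j (c : K) theta1 theta2 :
  beta_closed j theta1 -> beta_closed j theta2 ->
  beta_closed j (fun f => c *: theta1 f + theta2 f).
Proof.
move=> [m1 h1 x1 b1] [m2 h2 x2 b2]; split.
- have := is_multider_lin c%:MP 1 m1 m2; congr is_multider.
  by apply: functional_extensionality => f; rewrite mul_mpolyC mul1r.
- by move=> v; apply: rpredD (rpredZ _ (h1 v)) (h2 v).
- move=> f k i k0 fk; have [q1 ->] := x1 f k i k0 fk.
  have [q2 ->] := x2 f k i k0 fk; exists (c *: q1 + q2).
  by rewrite mulrDr scalerAr.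
- by move=> f k k0 fk; rewrite (b1 f k) // (b2 f k) // scaler0 addr0.
Qed.

Lemma beta_closed0 j : beta_closed j (fun=> 0).
Proof.
split=> //; last by move=> f k i _ _; exists 0; rewrite mulr0.
- split=> // f i; split=> [c g h|g h]; first by rewrite scaler0 addr0.
  by rewrite !mulr0 addr0.
- by move=> v; apply: dhomog0.
Qed.

Lemma beta_closed_sum j I (r : seq I) (P : pred I) (c : I -> K)
    (b : I -> {ffun 'I_p -> S} -> S) :
  (forall i, P i -> beta_closed j (b i)) ->
  beta_closed j (fun f => \sum_(i <- r | P i) c i *: b i f).
Proof.
move=> bP; elim: r => [|i r IH].
  have := beta_closed0 j; congr beta_closed.
  by apply: functional_extensionality => f; rewrite big_nil.
case Pi: (P i); last first.
  move: IH; congr beta_closed; apply: functional_extensionality => f.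
  by rewrite big_cons Pi.
have := beta_closed_lin (c i) (bP _ Pi) IH; congr beta_closed.
by apply: functional_extensionality => f; rewrite big_cons Pi.
Qed.

(** Exchanging argument [k] with the first one only changes the sign. *)
Lemma dvdX_any_argument theta :
    is_multider theta ->
    (forall f (k : 'I_p) i, k = 0%N :> nat -> f k = 'X_i ->
       exists q, theta f = 'X_i * q) ->
  forall f (k : 'I_p) i, f k = 'X_i -> exists q, theta f = 'X_i * q.
Proof.
move=> mt x f k i fk.
pose k0 := Ordinal (leq_ltn_trans (leq0n k) (ltn_ord k)).
have [kk|ne] := eqVneq k0 k; first by apply: (x f k) => //; rewrite -kk.
have [|q qE] := x [ffun k' => f (tperm k0 k k')] k0 i erefl.
  by rewrite ffunE tpermL.
by exists (- q); rewrite mulrN -qE multider_tperm // opprK.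
Qed.

(** The value at [f] of [x^u /\_{i in J} (d_i - d_i0)], the exterior product being written as a
    determinant. *)
Definition closed_basis u J f : S :=
  'X_[u] * \det (\matrix_(k < p, c < p) bder u J c (f k)).

Lemma closed_basis_varE u J (v : {ffun 'I_p -> 'I_l}) :
  closed_basis u J [ffun k => 'X_(v k)] =
  \det (\matrix_(k < p, c < p) ((elt J c == v k)%:R - (supp0 u == v k)%:R))
    *: 'X_[u].
Proof.
rewrite /closed_basis mulrC -mul_mpolyC; congr (_ * _).
rewrite -(det_map_mx (@mpolyC l K)); congr (\det _).
by apply/matrixP => k c; rewrite !mxE ffunE bderX.
Qed.

(** Bounding the degree by [N] makes the type of exponents finite; for [j < N] all exponents of
    degree [j] are present. *)
Definition closed_index (N j : nat) : {pred 'X_{1..l < N} * {set 'I_l}} :=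
  fun x => [&& mdeg x.1 == j, #|x.2| == p, [forall i in x.2, x.1 i != 0%N]
             & supp0 x.1 \notin x.2].

Lemma closed_basisP N j x : x \in @closed_index N j ->
  beta_closed j (closed_basis x.1 x.2).
Proof.
case: x => u J /and4P [/= /eqP uj /eqP Jp /forall_inP Ju u0J]; split.
- exact/is_multider_det/bder_derivation.
- move=> v; rewrite closed_basis_varE; apply/rpredZ.
  by rewrite dhomogX; apply/eqP.
- move=> f k i k0 fk.
  (* Either [x_i] divides [x^u], or row [k] of the determinant vanishes: its columns involve only
     [i0] and elements of [J], all in the support of [u] as soon as there is a column. *)
  have [iu|ui] := eqVneq (bmnm u i) 0%N; last first.
    have [q uE] := dvdX_mpolyX ui; rewrite /closed_basis uE -mulrA.
    by eexists.
  exists 0; rewrite mulr0 /closed_basis (expand_det_row _ k) big1 ?mulr0 //.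
  move=> c _; rewrite mxE fk bderX.
  have eJ : elt J c \in J by apply: set_elt_in.
  case: eqP => [ei|_]; first by have := Ju _ eJ; rewrite ei iu.
  case: eqP => [ei|_]; last by rewrite subrr mul0r.
  by have := supp0P (Ju _ eJ); rewrite ei iu.
- move=> f k k0 fk.
  rewrite /closed_basis (expand_det_row _ k) big1 ?mulr0 // => c _.
  by rewrite mxE fk bder_beta mul0r.
Qed.

(** These coefficients are coordinates dual to the family. For [u = u'] and [J = J'] the matrix is
    the identity because [i0] is outside [J']; for distinct sets an index of [J'] outside [J] gives
    a zero row. *)
Lemma coef_closed_basis u J u' J' : #|J| = p -> #|J'| = p ->
  supp0 u' \notin J' ->
  (closed_basis u J [ffun k => 'X_(elt J' k)])@_u' =
  ((u == u') && (J == J'))%:R.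
Proof.
move=> Jp Jp' u0J'.
have -> : [ffun k => 'X_(elt J' k)] =
          [ffun k => 'X_([ffun k => elt J' k] k)] :> {ffun 'I_p -> S}.
  by apply/ffunP => k; rewrite !ffunE.
rewrite closed_basis_varE mcoeffZ mcoeffX.
case: (eqVneq u u') => [uu'|_]; last by rewrite mulr0.
rewrite mulr1 /= uu'; case: (eqVneq J J') => [JJ'|ne].
  rewrite (_ : \matrix_(_, _) _ = 1%:M) ?det1 //.
  apply/matrixP => k c; rewrite !mxE ffunE JJ' (inj_eq (set_elt_inj Jp')) eq_sym.
  case: (supp0 u' =P _) => [e|_]; last by rewrite subr0.
  by have := set_elt_in ord0 k Jp'; rewrite -e (negPf u0J').
have /subsetPn [i iJ' iJ] : ~~ (J' \subset J).
  by apply: contra ne => sJ; rewrite eq_sym eqEcard sJ Jp Jp' leqnn.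
have [k ki] := set_elt_onto ord0 Jp' iJ'.
rewrite (expand_det_row _ k) big1 // => c _; rewrite mxE ffunE ki.
case: eqP => [ei|_]; first by rewrite -ei (set_elt_in ord0 c Jp) in iJ.
case: eqP => [ei|_]; last by rewrite subrr mul0r.
by rewrite ei iJ' in u0J'.
Qed.

(* Contraction with [beta] expresses a coefficient whose index contains
   [supp0 u] through those whose index does not. *)
Lemma beta_closed_eq0 j theta : beta_closed j theta ->
    (forall u J, mdeg u = j -> #|J| = p -> {in J, forall i, u i != 0%N} ->
       supp0 u \notin J -> (theta [ffun k => 'X_(elt J k)])@_u = 0) ->
  forall f, theta f = 0.
Proof.
move=> [mt ht xt bt] coef0; apply: multider_eq0 => // v.
apply/mpolyP => u; rewrite mcoeff0.
have [uj|ne] := eqVneq (mdeg u) j; last exact: dhomog_nemf_coeff (ht v) ne.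
have noninj (w : {ffun 'I_p -> 'I_l}) : ~~ injectiveb w ->
    theta [ffun k => 'X_(w k)] = 0.
  move=> /injectivePn [i [i' ne ww]]; have [_ alt] := mt.
  by apply: (alt _ i i' ne); rewrite !ffunE ww.
(* For injective [w] with image [J]: if [J] lies in the support of [u], sort the arguments and use
   [coef0]; otherwise [x_i] divides the value for some [i] with [u i = 0]. *)
have avoid (w : {ffun 'I_p -> 'I_l}) : (forall k, w k != supp0 u) ->
    (theta [ffun k => 'X_(w k)])@_u = 0.
  move=> wu; case: (boolP (injectiveb w)) => [/injectiveP injw|/noninj ->];
    last by rewrite mcoeff0.
  have [s sE] := inj_set_elt ord0 injw; set J := w @: setT in sE.
  have Jp : #|J| = p by rewrite card_imset // cardsT card_ord.
  have [/forall_inP Ju|/forall_inPn [i iJ]] := boolP [forall i in J, u i != 0%N].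
    have -> : [ffun k => 'X_(w k)] =
        [ffun k => [ffun k => 'X_(elt J k)] (s k)] :> {ffun 'I_p -> S}.
      by apply/ffunP => k; rewrite !ffunE sE.
    rewrite multider_perm // -signr_odd; case: (odd _).
      rewrite expr1 mulN1r mcoeffN coef0 ?oppr0 //.
      by apply/imsetP => -[k _ wk]; have := wu k; rewrite wk eqxx.
    rewrite expr0 mul1r coef0 //.
    by apply/imsetP => -[k _ wk]; have := wu k; rewrite wk eqxx.
  have /imsetP [k _ ik] := iJ; rewrite negbK => /eqP ui0.
  have [q ->] : exists q, theta [ffun k => 'X_(w k)] = 'X_i * q.
    by apply: (dvdX_any_argument mt xt (k := k)); rewrite ffunE ik.
  exact: coefXM_eq0.
have [/forallP/avoid //|/forallPn [k]] := boolP [forall k, v k != supp0 u].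
rewrite negbK => /eqP vk.
case: (boolP (injectiveb v)) => [/injectiveP injv|/noninj ->];
  last by rewrite mcoeff0.
pose k0 := Ordinal (leq_ltn_trans (leq0n k) (ltn_ord k)).
(* Up to sign, [i0] may be moved to the first argument, where [beta] can then be substituted. *)
suff front (w : {ffun 'I_p -> 'I_l}) : injective w -> w k0 = supp0 u ->
    (theta [ffun k => 'X_(w k)])@_u = 0.
  have [kk|ne] := eqVneq k0 k; first by apply: front; rewrite ?kk.
  pose w := [ffun k' => v (tperm k0 k k')].
  have -> : [ffun k => 'X_(v k)] =
      [ffun k' => [ffun k => 'X_(w k)] (tperm k0 k k')] :> {ffun 'I_p -> S}.
    by apply/ffunP => k'; rewrite !ffunE tpermK.
  rewrite multider_tperm // mcoeffN front ?oppr0 //; last by rewrite ffunE tpermL.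
  by move=> i i'; rewrite !ffunE => /injv /perm_inj.
move=> injw wk0; set f := [ffun _ => _].
have := bt (subst_at f k0 beta) k0 erefl; rewrite ffunE eqxx => /(_ erefl).
have [der _] := mt; rewrite (derivation_sum (der f k0)).
move=> /(congr1 (mcoeff u)); rewrite raddf_sum mcoeff0 (bigD1 (supp0 u)) //=.
rewrite -wk0 big1 ?addr0 => [|i ine].
  by rewrite (_ : subst_at _ _ _ = f) // -[RHS](subst_at_id f k0) ffunE.
have -> : subst_at f k0 'X_i =
    [ffun k => 'X_([ffun k => if k == k0 then i else w k] k)].
  by apply/ffunP => k'; rewrite !ffunE; case: eqP.
apply: avoid => k'; rewrite ffunE -wk0; case: (eqVneq k' k0) => // ne.
by rewrite (inj_eq injw).
Qed.

Lemma closed_index_neq N (x y : 'X_{1..l < N} * {set 'I_l}) :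
  x != y -> (x.1 == y.1 :> 'X_{1..l}) && (x.2 == y.2) = false.
Proof.
move=> ne; apply: contraNF ne; case: x y => [u J] [u' J'] /= /andP [uu' /eqP ->].
by rewrite xpair_eqE eqxx andbT bmeqP.
Qed.

Lemma coef_closed_comb N j (c : 'X_{1..l < N} * {set 'I_l} -> K) y :
  y \in @closed_index N j ->
  (\sum_(x in @closed_index N j)
     c x *: closed_basis x.1 x.2 [ffun k => 'X_(elt y.2 k)])@_(y.1) = c y.
Proof.
move=> yP; have /and4P [_ /eqP yp _ y0] := yP.
rewrite raddf_sum (bigD1 y) //= big1 => [|x /andP [xP ne]].
  by rewrite addr0 mcoeffZ coef_closed_basis // !eqxx mulr1.
have /and4P [_ /eqP xp _ _] := xP.
by rewrite mcoeffZ coef_closed_basis // (closed_index_neq ne) mulr0.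
Qed.

Lemma closed_basis_free N j (c : 'X_{1..l < N} * {set 'I_l} -> K) :
  (forall f, \sum_(x in @closed_index N j) c x *: closed_basis x.1 x.2 f = 0) ->
  forall x, x \in @closed_index N j -> c x = 0.
Proof. by move=> c0 x xP; rewrite -(coef_closed_comb c xP) c0 mcoeff0. Qed.

(** The [c x] are the dual coordinates of [theta]. The difference between [theta] and the resulting
    combination has all of these equal to zero, so [beta_closed_eq0] applies. *)
Lemma closed_basis_span N j theta : (j < N)%N -> beta_closed j theta ->
  exists c : 'X_{1..l < N} * {set 'I_l} -> K, forall f,
    theta f = \sum_(x in @closed_index N j) c x *: closed_basis x.1 x.2 f.
Proof.
move=> jN bt; pose c (x : 'X_{1..l < N} * {set 'I_l}) :=
  (theta [ffun k => 'X_(elt x.2 k)])@_(x.1).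
exists c => f; apply/eqP; rewrite -subr_eq0 addrC; apply/eqP.
have bs : beta_closed j (fun f =>
    \sum_(x in @closed_index N j) c x *: closed_basis x.1 x.2 f).
  by apply: beta_closed_sum => x; apply: closed_basisP.
have := beta_closed_lin (-1) bs bt; move/beta_closed_eq0 => eq0.
rewrite -scaleN1r; apply: eq0 => u J uj Jp Ju u0J.
have uN : (mdeg u < N)%N by rewrite uj.
pose y := (BMultinom uN, J).
have yP : y \in @closed_index N j.
  by apply/and4P; split; rewrite /= ?uj ?Jp //; apply/forall_inP.
rewrite mcoeffD mcoeffZ (coef_closed_comb c yP) mulN1r.
exact: addNr.
Qed.

End FixedNumberOfArguments.
End CoordinateArrangement.

(** * The splitting of [D^p] by the Euler derivation *)

Section LogarithmicBasis.
Variables (K : fieldType) (n : nat).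
Local Notation l := n.+2.
Local Notation S := {mpoly K[l]}.
Local Notation beta := (beta K n).
Implicit Types (u : 'X_{1..l}) (J : {set 'I_l}).

(** The degree [j] part of [D^p] for the forms [x_1, ..., x_l] and [beta]. *)
Definition log_coordinate p (j : nat) (theta : {ffun 'I_p -> S} -> S) : Prop :=
  [/\ is_multider theta, multider_homog j theta,
      forall (f : {ffun 'I_p -> S}) (k : 'I_p) i, k = 0%N :> nat ->
        f k = 'X_i -> exists q, theta f = 'X_i * q &
      forall (f : {ffun 'I_p -> S}) (k : 'I_p), k = 0%N :> nat ->
        f k = beta -> exists q, theta f = beta * q].

Lemma pihomog_beta d (q : S) :
  pihomog mdeg d.+1 (beta * q) = beta * pihomog mdeg d q.
Proof.
elim/mpolyind: q => [|c m q _ _ IH]; first by rewrite !(mulr0, pihomog0).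
rewrite mulrDr !pihomogD IH mulrDr; congr (_ + _).
rewrite -scalerAr !linearZ -scalerAr /=; congr (_ *: _).
rewrite mulr_suml raddf_sum pihomogX /= mulr_suml.
apply: eq_bigr => i _; rewrite -mpolyXD pihomogX /= mdegD mdeg1 add1n eqSS.
by case: ifP => _; rewrite ?mulr0 ?mpolyXD.
Qed.

(** Otherwise the component of [beta * q] in degree [(mdeg m).+1] would be zero. It is [beta] times
    the component of [q] in degree [mdeg m], which is nonzero because of its coefficient at [m]. *)
Lemma dhomog_beta_factor j (q : S) m :
  beta * q \is j.-homog -> q@_m != 0 -> j = (mdeg m).+1.
Proof.
move=> hq qm; apply/eqP; apply: contraNT qm => ne.
have: pihomog mdeg (mdeg m).+1 (beta * q) = 0.
  exact: pihomog_ne0 ne hq.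
rewrite pihomog_beta => /eqP; rewrite mulf_eq0 (negPf (beta_neq0 K n)) /=.
rewrite pihomogE => /eqP /(congr1 (mcoeff m)); rewrite mcoeff0 raddf_sum /=.
have [mq|/memN_msupp_eq0 -> //] := boolP (m \in msupp q).
rewrite big_mkcond (bigD1_seq m) ?msupp_uniq //= eqxx mcoeffZ mcoeffX eqxx mulr1.
rewrite big1 ?addr0 => [->//|m' ne'].
by case: ifP => _; rewrite ?mcoeff0 // mcoeffZ mcoeffX (negPf ne') mulr0.
Qed.

(** [x_i] is coprime to [beta]: setting [x_i] to zero kills [beta * q] but not [beta], hence it
    kills [q]. *)
Lemma dvdX_beta_factor i (q q' : S) :
  beta * q = 'X_i * q' -> exists r, q = 'X_i * r.
Proof.
pose ev := @comp_mpoly l K l [tuple if j == i then 0 else 'X_j | j < l].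
have evX j : ev 'X_j = if j == i then 0 else 'X_j.
  by rewrite /ev comp_mpolyXU -tnth_nth tnth_mktuple.
(* Modulo [x_i] a polynomial agrees with its value at [x_i = 0]. For monomials this goes by
   induction on the degree. *)
have evE (g : S) : exists r, g = ev g + 'X_i * r.
  elim/mpolyind: g => [|c m g _ _ [r rE]].
    by exists 0; rewrite mulr0 addr0 /ev comp_mpoly0.
  suff [r' r'E] : exists r, 'X_[m] = ev 'X_[m] + 'X_i * r.
    exists (c *: r' + r); rewrite /ev comp_mpolyD comp_mpolyZ -/ev.
    rewrite {1}rE {1}r'E scalerDr mulrDr -scalerAr -!addrA; congr (_ + _).
    by rewrite addrCA.
  elim: {g rE r}(mdeg m) {-2}m (erefl (mdeg m)) => [|d IH] {}m.
    move/eqP; rewrite mdeg_eq0 => /eqP ->; exists 0.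
    by rewrite mpolyX0 mulr0 addr0 /ev comp_mpoly1.
  move=> md; have [k mk] : exists k, m k != 0%N.
    apply/existsP; apply: contra_eqT md => /existsPn m0.
    by rewrite mdegE big1 // => k _; apply/eqP/negPn.
  have mE : (U_(k) + (m - U_(k)))%MM = m by rewrite addmC submK // lep1mP.
  have [|r rE] := IH (m - U_(k))%MM.
    by move: md; rewrite -{1}mE mdegD mdeg1 add1n => -[].
  rewrite -mE mpolyXD /ev rmorphM /= -/ev evX.
  case: eqP => [->|_]; first by exists 'X_[m - U_(i)]; rewrite mul0r add0r.
  by exists ('X_k * r); rewrite {1}rE mulrDr mulrCA.
move=> /(congr1 ev); rewrite /ev !rmorphM /= -/ev evX eqxx mul0r.
move/eqP; rewrite mulf_eq0 => /orP [/eqP evb0|/eqP evq0]; last first.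
  by have [r rE] := evE q; exists r; rewrite {1}rE evq0 add0r.
(* There are at least two variables, so one other than [x_i] survives in [beta]. *)
have [k ki] : exists k : 'I_l, k != i.
  by case: (eqVneq ord0 i) => [<-|]; [exists (lift ord0 ord0)|exists ord0].
move: evb0; rewrite /ev raddf_sum /= -/ev => /(congr1 (mderiv k)).
rewrite mderiv0 (derivation_sum (mderiv_derivation K k)) (bigD1 k) //= evX.
rewrite (negPf ki) mderivXU eqxx big1 => [/eqP|j jk]; first by rewrite addr0 oner_eq0.
by rewrite evX; case: ifP => _; rewrite ?mderiv0 // mderivXU eq_sym (negPf jk).
Qed.

Section Wedge.
Variable p : nat.

Definition wedge_der u J (c : 'I_p.+1) : S -> S :=
  if unlift ord0 c is Some c' then bder u J c' else @euler K l.

(* The exterior product of the Euler derivation with [closed_basis u J]. *)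
Definition wedge_basis u J (f : {ffun 'I_p.+1 -> S}) : S :=
  'X_[u] * \det (\matrix_(k, c) wedge_der u J c (f k)).

(** Precomposition with [cons_arg h] is contraction with [h]. *)
Definition cons_arg (h : S) (f : {ffun 'I_p -> S}) : {ffun 'I_p.+1 -> S} :=
  [ffun k => if unlift ord0 k is Some k' then f k' else h].

Lemma cons_arg0 h f : cons_arg h f ord0 = h.
Proof. by rewrite ffunE unlift_none. Qed.

Lemma cons_argS h f k : cons_arg h f (lift ord0 k) = f k.
Proof. by rewrite ffunE liftK. Qed.

Lemma cons_arg_eta (f : {ffun 'I_p.+1 -> S}) :
  cons_arg (f ord0) [ffun k => f (lift ord0 k)] = f.
Proof.
by apply/ffunP => k; rewrite ffunE; case: unliftP => [k' ->|->]; rewrite ?ffunE.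
Qed.

Lemma subst_cons_arg h f i g :
  subst_at (cons_arg h f) (lift ord0 i) g = cons_arg h (subst_at f i g).
Proof.
apply/ffunP => k; rewrite !ffunE; case: unliftP => [k' ->|->].
  by rewrite (inj_eq lift_inj) !ffunE.
by rewrite (negPf (neq_lift _ _)).
Qed.

Lemma subst_cons_arg0 h f g : subst_at (cons_arg h f) ord0 g = cons_arg g f.
Proof.
by apply/ffunP => k; rewrite !ffunE; case: unliftP => [k' ->|->].
Qed.

Lemma wedge_der_derivation u J c : is_derivation (wedge_der u J c).
Proof.
rewrite /wedge_der; case: unlift => [c'|]; first exact: bder_derivation.
exact: euler_derivation.
Qed.

(** Laplace expansion along the first row leaves only the Euler column. *)
Lemma wedge_expand_row0 u J (f : {ffun 'I_p.+1 -> S}) :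
  (forall c : 'I_p, bder u J c (f ord0) = 0) ->
  wedge_basis u J f =
  euler (f ord0) * closed_basis u J [ffun k => f (lift ord0 k)].
Proof.
move=> b0; rewrite /wedge_basis /closed_basis (expand_det_row _ ord0) big_ord_recl.
rewrite big1 ?addr0 => [|c _]; last first.
  by rewrite mxE /wedge_der liftK b0 mul0r.
rewrite mxE /wedge_der unlift_none mulrCA /cofactor expr0 mul1r.
congr (_ * (_ * \det _)); apply/matrixP => k c.
by rewrite !mxE liftK ffunE.
Qed.

Lemma wedge_basis_beta u J f :
  wedge_basis u J (cons_arg beta f) = beta * closed_basis u J f.
Proof.
rewrite wedge_expand_row0 cons_arg0 ?euler_beta => [|c]; last exact: bder_beta.
by congr (_ * closed_basis _ _ _); apply/ffunP => k; rewrite ffunE cons_argS.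
Qed.

(** In the expansion along the Euler column the entries are variables and the cofactors are
    constants, so one degree is added to that of [x^u]. *)
Lemma wedge_basis_homog u J : multider_homog (mdeg u).+1 (wedge_basis u J).
Proof.
move=> v; rewrite -[(mdeg u).+1]addn1; apply: dhomogM; first by rewrite dhomogX.
rewrite (expand_det_col _ ord0); apply: rpred_sum => k _.
rewrite mxE ffunE /wedge_der unlift_none eulerX -[1%N]addn0.
apply: dhomogM; first by rewrite dhomogX; apply/eqP/mdeg1.
pose M := \matrix_(k' < p, c < p)
  ((set_elt ord0 J c == v (lift k k'))%:R - (supp0 u == v (lift k k'))%:R : K).
have -> : cofactor (\matrix_(k, c) wedge_der u J c
    ([ffun k => 'X_(v k)] k)) k ord0 = ((-1) ^+ (k + 0) * \det M)%:MP.
  rewrite mpolyCM rmorphXn rmorphN1 /cofactor; congr (_ * _).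
  rewrite -(det_map_mx (@mpolyC l K)); congr (\det _).
  by apply/matrixP => k' c; rewrite !mxE ffunE /wedge_der liftK bderX.
by rewrite -[_%:MP]mulr1 mul_mpolyC; apply/rpredZ/dhomog1.
Qed.

(** The Euler derivation has degree 1, which leaves [j.-1] for the other factor; the guard [0 < j]
    is there because [0.-1] is [0]. *)
Definition wedge_index (N j : nat) : {pred 'X_{1..l < N} * {set 'I_l}} :=
  fun x => (0 < j)%N && (x \in @closed_index n p N j.-1).

Lemma wedge_basisP N j x : x \in @wedge_index N j ->
  log_coordinate j (wedge_basis x.1 x.2).
Proof.
case: j => // j /andP [_]; case: x => u J xP.
have /and4P [/= /eqP uj /eqP Jp /forall_inP Ju u0J] := xP; split.
- exact/is_multider_det/wedge_der_derivation.
- by rewrite -uj; apply: wedge_basis_homog.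
- move=> f k i k0 fk; have {k0} k0 : k = ord0 by apply: val_inj.
  have [iu|ui] := eqVneq (bmnm u i) 0%N; last first.
    have [q uE] := dvdX_mpolyX K ui; rewrite /wedge_basis uE -mulrA.
    by eexists.
  (* Outside the support of [u] every [bder u J c] kills [x_i], and the Euler derivation supplies
     the factor [x_i]. *)
  rewrite wedge_expand_row0 -k0 fk ?eulerX; first by eexists.
  move=> c; rewrite bderX.
  have eJ : set_elt ord0 J c \in J by apply: set_elt_in.
  case: eqP => [ei|_]; first by have := Ju _ eJ; rewrite ei iu.
  case: eqP => [ei|_]; last by rewrite subrr.
  by have := supp0P (Ju _ eJ); rewrite ei iu.
- move=> f k k0 fk; have {k0} k0 : k = ord0 by apply: val_inj.
  by rewrite -[f]cons_arg_eta -k0 fk wedge_basis_beta; eexists.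
Qed.

Lemma log_coordinate_lin j (c : K) (theta1 theta2 : {ffun 'I_p.+1 -> S} -> S) :
  log_coordinate j theta1 -> log_coordinate j theta2 ->
  log_coordinate j (fun f => c *: theta1 f + theta2 f).
Proof.
move=> [m1 h1 x1 b1] [m2 h2 x2 b2]; split.
- have := is_multider_lin c%:MP 1 m1 m2; congr is_multider.
  by apply: functional_extensionality => f; rewrite mul_mpolyC mul1r.
- by move=> v; apply: rpredD (rpredZ _ (h1 v)) (h2 v).
- move=> f k i k0 fk; have [q1 ->] := x1 f k i k0 fk.
  have [q2 ->] := x2 f k i k0 fk; exists (c *: q1 + q2).
  by rewrite mulrDr scalerAr.
- move=> f k k0 fk; have [q1 ->] := b1 f k k0 fk.
  have [q2 ->] := b2 f k k0 fk; exists (c *: q1 + q2).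
  by rewrite mulrDr scalerAr.
Qed.

Lemma log_coordinate_subsum j I (r : seq I) (P : pred I) (c : I -> K)
    (b : I -> {ffun 'I_p.+1 -> S} -> S) theta :
  log_coordinate j theta -> (forall i, P i -> log_coordinate j (b i)) ->
  log_coordinate j (fun f => theta f - \sum_(i <- r | P i) c i *: b i f).
Proof.
move=> Dt bP; elim: r => [|i r IH].
  move: Dt; congr log_coordinate.
  by apply: functional_extensionality => f; rewrite big_nil subr0.
case Pi: (P i); last first.
  move: IH; congr log_coordinate; apply: functional_extensionality => f.
  by rewrite big_cons Pi.
have := log_coordinate_lin (- c i) (bP _ Pi) IH; congr log_coordinate.
apply: functional_extensionality => f; rewrite big_cons Pi scaleNr opprD.
by rewrite addrCA.
Qed.

(** The quotient by [beta] inherits the identities of the contraction since [beta] is not a zero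
    divisor. Its degree is one less than that of [theta], which forces it to vanish for [j = 0]. *)
Lemma log_coordinate_contract j theta : log_coordinate j theta ->
  exists g : {ffun 'I_p -> S} -> S,
    [/\ forall f, theta (cons_arg beta f) = beta * g f,
        forall m, j = m.+1 -> beta_closed m g &
        j = 0%N -> forall f, g f = 0].
Proof.
move=> [mt ht xt bt]; have [der alt] := mt.
have ex f : exists q, theta (cons_arg beta f) = beta * q.
  by apply: (bt _ ord0) => //; rewrite cons_arg0.
pose g f := proj1_sig (constructive_indefinite_description _ (ex f)).
have gE f : theta (cons_arg beta f) = beta * g f.
  by rewrite /g; case: constructive_indefinite_description.
have mg : is_multider g.
  split=> [f i|f i i' ne ff].
    have [lin leib] := der (cons_arg beta f) (lift ord0 i).
    split=> [c a b|a b]; apply: (mulfI (beta_neq0 K n)).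
      by have := lin c a b; rewrite !subst_cons_arg !gE mulrDr scalerAr.
    have := leib a b; rewrite !subst_cons_arg !gE => ->; ring.
  apply: (mulfI (beta_neq0 K n)); rewrite -gE mulr0.
  by apply: (alt _ (lift ord0 i) (lift ord0 i')); rewrite ?(inj_eq lift_inj) ?cons_argS.
have hg (v : {ffun 'I_p -> 'I_l}) : beta * g [ffun k => 'X_(v k)] \is j.-homog.
  rewrite -gE -(subst_cons_arg0 0) (derivation_sum (der _ _)).
  apply: rpred_sum => i _; rewrite subst_cons_arg0.
  pose w : {ffun 'I_p.+1 -> 'I_l} :=
    [ffun k => if unlift ord0 k is Some k' then v k' else i].
  rewrite (_ : cons_arg _ _ = [ffun k => 'X_(w k)]); first exact: ht.
  by apply/ffunP => k; rewrite !ffunE; case: unlift => // k'; rewrite ffunE.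
exists g; split=> // [m jm|j0].
  split=> //.
  - move=> v; apply/dhomogP => u; rewrite mcoeff_msupp => gu.
    by have := dhomog_beta_factor (hg v) gu; rewrite jm => -[].
  (* [x_i] divides [beta * g f] and is coprime to [beta]. *)
  - move=> f k i _ fk.
    have [|q qE] := dvdX_any_argument mt xt (f := cons_arg beta f)
      (k := lift ord0 k) (i := i); first by rewrite cons_argS.
    by apply: (dvdX_beta_factor (q' := q)); rewrite -gE.
  - move=> f k _ fk; apply: (mulfI (beta_neq0 K n)); rewrite mulr0 -gE.
    by apply: (alt _ ord0 (lift ord0 k)); rewrite ?neq_lift // cons_arg0 cons_argS.
apply: multider_eq0 => // v; apply/mpolyP => u; rewrite mcoeff0.
apply/eqP; apply: contraT => /(dhomog_beta_factor (hg v)).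
by rewrite j0.
Qed.

(** Contraction with [beta] kills the first family and turns the second into [beta] times basis
    elements of [Z_p]. *)
Theorem has_dim_log_coordinate N j : (j < N)%N ->
  has_dim (@log_coordinate p.+1 j)
    (#|@closed_index n p.+1 N j| + #|@wedge_index N j|).
Proof.
move=> jN; set I := ('X_{1..l < N} * {set 'I_l})%type.
apply: (@has_dim_card_add _ _ _ _ _ _
  (fun x : I => @closed_basis K n p.+1 x.1 x.2) (fun x : I => wedge_basis x.1 x.2)).
- move=> x /(closed_basisP K) [m h xP b0]; split=> // f k k0 fk.
  by exists 0; rewrite (b0 f k) // mulr0.
- exact: wedge_basisP.
- move=> c1 c2 c0.
  (* Contracting the relation with [beta] isolates the second family, and [beta] cancels. *)
  have c20 (f : {ffun 'I_p -> S}) :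
      \sum_(x in @wedge_index N j) c2 x *: closed_basis x.1 x.2 f = 0.
    set w := \sum_(x in _) _; suff /eqP : beta * w = 0.
      by rewrite mulf_eq0 (negPf (beta_neq0 K n)) => /eqP.
    rewrite -[RHS](c0 (cons_arg beta f)).
    rewrite -[LHS]add0r; congr (_ + _).
      apply/esym/big1 => x /(closed_basisP K) [_ _ _ b0].
      by rewrite (b0 _ ord0) ?scaler0 ?cons_arg0.
    rewrite mulr_sumr; apply: eq_bigr => x _.
    by rewrite wedge_basis_beta -scalerAr.
  have c2P x : x \in @wedge_index N j -> c2 x = 0.
    move=> xP; have /andP [j0 xP'] := xP.
    apply: (closed_basis_free (c := c2) _ xP') => f.
    rewrite -[RHS](c20 f); apply: eq_bigl => y.
    by rewrite /wedge_index unfold_in j0.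
  split=> // x; apply: (closed_basis_free (c := c1)) => f.
  rewrite -[RHS](c0 f) [X in _ + X]big1 ?addr0 // => y yP.
  by rewrite c2P // scale0r.
- move=> theta Dt; have [g [gE gcl g0]] := log_coordinate_contract Dt.
  have [c2 c2E] : exists c : I -> K, forall f, g f =
      \sum_(x in @wedge_index N j) c x *: closed_basis x.1 x.2 f.
    case: j jN Dt gcl g0 => [|j] jN Dt gcl g0.
      by exists (fun=> 0) => f; rewrite g0 // big1 // => x _; rewrite scale0r.
    exact: closed_basis_span (ltnW jN) (gcl j erefl).
  (* What remains has zero contraction with [beta], so it lies in [Z_{p+1}]. *)
  pose theta' f := theta f -
    \sum_(x in @wedge_index N j) c2 x *: wedge_basis x.1 x.2 f.
  have cl : beta_closed j theta'.
    have := @log_coordinate_subsum j _ (index_enum I) _ c2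
      (fun x => wedge_basis x.1 x.2) _ Dt (@wedge_basisP N j).
    move=> [m h x _]; split=> // f k k0 fk.
    have {k0} k0 : k = ord0 by apply: val_inj.
    rewrite /theta' -[f]cons_arg_eta -k0 fk gE c2E mulr_sumr.
    under [X in _ - X]eq_bigr do rewrite wedge_basis_beta scalerAr.
    by rewrite subrr.
  have [c1 c1E] := closed_basis_span jN cl.
  by exists c1, c2 => f; apply: (canRL (subrK _) (c1E f)).
Qed.

End Wedge.

(** With no argument there is nothing to contract: [D^0] and [Z_0] are both [S]. *)
Lemma has_dim_log_coordinate0 N j : (j < N)%N ->
  has_dim (@log_coordinate 0 j) #|@closed_index n 0 N j|.
Proof.
move=> jN; apply: (@has_dim_card _ _ _ _ _
  (fun x : 'X_{1..l < N} * {set 'I_l} => @closed_basis K n 0 x.1 x.2)).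
- by move=> x /(closed_basisP K) [m h xP _]; split=> // f [].
- by move=> c c0 x; apply: closed_basis_free.
- move=> theta [m h x _]; apply: closed_basis_span => //.
  by split=> // f [].
Qed.

End LogarithmicBasis.

(** * Linear changes of coordinates *)

Section LinearSubstitution.
Variables (K : fieldType) (l : nat).
Local Notation S := {mpoly K[l]}.
Implicit Types (M N : 'M[K]_l).

Definition linsubst M : S -> S :=
  comp_mpoly [tuple \sum_j M i j *: 'X_j | i < l].

HB.instance Definition _ M := GRing.LRMorphism.on (linsubst M).

Lemma linsubstX M i : linsubst M 'X_i = \sum_j M i j *: 'X_j.
Proof. by rewrite /linsubst comp_mpolyXU -tnth_nth tnth_mktuple. Qed.

Lemma linsubst_sum M I (r : seq I) (P : pred I) (F : I -> S) :
  linsubst M (\sum_(i <- r | P i) F i) = \sum_(i <- r | P i) linsubst M (F i).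
Proof. exact: (raddf_sum (linsubst M)). Qed.

Lemma linsubstXm M m :
  linsubst M 'X_[m] = \prod_i linsubst M 'X_i ^+ m i.
Proof. by rewrite mpolyXE_id rmorph_prod; apply: eq_bigr => i _; rewrite rmorphXn. Qed.

Lemma linsubstK M N : M *m N = 1%:M -> cancel (linsubst M) (linsubst N).
Proof.
move=> MN g; suff mono m : linsubst N (linsubst M 'X_[m]) = 'X_[m].
  rewrite [g]mpolyE (linsubst_sum M) (linsubst_sum N); apply: eq_bigr => m _.
  by rewrite !linearZ /= mono.
rewrite linsubstXm rmorph_prod mpolyXE_id; apply: eq_bigr => i _.
rewrite rmorphXn /= linsubstX; congr (_ ^+ _).
rewrite linsubst_sum; under eq_bigr do rewrite linearZ /= linsubstX scaler_sumr.
rewrite exchange_big (bigD1 i) //= [X in _ + X]big1 => [|k ki].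
  under eq_bigr do rewrite scalerA.
  rewrite -scaler_suml addr0.
  have /matrixP/(_ i i) := MN; rewrite !mxE eqxx => ->.
  exact: scale1r.
under eq_bigr do rewrite scalerA.
rewrite -scaler_suml; have /matrixP/(_ i k) := MN; rewrite !mxE => ->.
by rewrite eq_sym (negPf ki) scale0r.
Qed.

Lemma linsubst_homog M j g : g \is j.-homog -> linsubst M g \is j.-homog.
Proof.
move=> /dhomogP hg; rewrite [g]mpolyE linsubst_sum big_seq.
apply: rpred_sum => m /hg md; rewrite linearZ /=; apply: rpredZ.
rewrite linsubstXm -md /= mdegE.
apply: (big_rec2 (fun (a : S) (d : nat) => a \is d.-homog)) => [|i a d _ da].
  exact: dhomog1.
apply: dhomogM da; have h1 : linsubst M 'X_i \is 1.-homog.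
  rewrite linsubstX; apply: rpred_sum => k _; apply: rpredZ.
  by rewrite dhomogX; apply/eqP/mdeg1.
by have := dhomogMn (m i) h1; rewrite mul1n.
Qed.

Section Conjugation.
Variable p : nat.
Implicit Types (theta : {ffun 'I_p -> S} -> S) (f : {ffun 'I_p -> S}).

Definition conj_multider M N theta f : S :=
  linsubst N (theta [ffun k => linsubst M (f k)]).

Definition divides_first (a : S) theta : Prop :=
  forall f (k : 'I_p), k = 0%N :> nat -> f k = a -> exists q, theta f = a * q.

Lemma divides_first_scale a c theta : is_multider theta ->
  divides_first a theta -> divides_first (c *: a) theta.
Proof.
move=> [der _] da f k k0 fk.
have [|q qE] := da (subst_at f k a) k k0; first by rewrite ffunE eqxx.
exists q; rewrite -scalerAl -qE -(derivationZ (der f k)) -fk.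
by rewrite subst_at_id.
Qed.

Variables (M N : 'M[K]_l).
Hypotheses (MN : M *m N = 1%:M) (NM : N *m M = 1%:M).

Lemma conj_multiderK theta f :
  conj_multider N M (conj_multider M N theta) f = theta f.
Proof.
rewrite /conj_multider (linsubstK NM); congr theta.
by apply/ffunP => k; rewrite !ffunE (linsubstK NM).
Qed.

Lemma is_multider_conj theta :
  is_multider theta -> is_multider (conj_multider M N theta).
Proof.
move=> [der alt]; split=> [f i|f i j ne ff]; last first.
  by rewrite /conj_multider (alt _ i j ne) ?raddf0 // !ffunE ff.
have sub g : [ffun k => linsubst M (subst_at f i g k)] =
    subst_at [ffun k => linsubst M (f k)] i (linsubst M g).
  by apply/ffunP => k; rewrite !ffunE; case: eqP.
have [lin leib] := der [ffun k => linsubst M (f k)] i.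
split=> [c g h|g h]; rewrite /conj_multider !sub.
  by rewrite linearP lin linearP.
rewrite (rmorphM (linsubst M)) leib raddfD /= !(rmorphM (linsubst N)) /=.
by rewrite !(linsubstK MN).
Qed.

(** [linsubst M] turns variables into linear forms, on which [theta] expands into scalar
    combinations of its values at variables. *)
Lemma multider_homog_conj j theta : is_multider theta ->
  multider_homog j theta -> multider_homog j (conj_multider M N theta).
Proof.
move=> mt ht v; apply: linsubst_homog.
apply: (@multider_var_ind K l p
  (fun g => exists c : 'I_l -> K, g = \sum_i c i *: 'X_i)
  (fun g => g \is j.-homog)) => //.
  move=> d der dX g [c ->]; rewrite (derivation_sum der).
  by apply: rpred_sum => i _; rewrite (derivationZ der); apply/rpredZ/dX.
by move=> k; rewrite !ffunE linsubstX; eexists.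
Qed.

Lemma divides_first_conj a theta :
  divides_first a theta -> divides_first (linsubst N a) (conj_multider M N theta).
Proof.
move=> da f k k0 fk; have [|q qE] := da [ffun k => linsubst M (f k)] k k0.
  by rewrite ffunE fk (linsubstK NM).
by exists (linsubst N q); rewrite /conj_multider qE rmorphM.
Qed.

End Conjugation.
End LinearSubstitution.

(** * Reduction of a generic arrangement to coordinate form *)

Section GenericArrangement.
Variables (K : fieldType) (n : nat).
Local Notation l := n.+2.
Local Notation S := {mpoly K[l]}.
Implicit Type A : 'M[K]_(l.+1, l).

Definition coordinate_form (H : 'I_l.+1) : S :=
  if unlift ord_max H is Some i then 'X_i else beta K n.

(* Scaling the first [l] forms so that the last one becomes their sum. *)
Lemma generic_coordinates A : any_l_independent A ->
  exists M N : 'M[K]_l, [/\ M *m N = 1%:M, N *m M = 1%:M &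
    forall H, exists2 a, a != 0 &
      linform A H = a *: linsubst M (coordinate_form H)].
Proof.
move=> indep; pose B := rowsub (lift ord_max) A : 'M_l.
have freeB : row_free B by apply/indep/lift_inj.
have unitB : B \in unitmx by rewrite -row_free_unit.
(* The coefficients of the last form in the basis given by the first [l] forms. *)
pose c := row ord_max A *m invmx B.
have cB : c *m B = row ord_max A by rewrite mulmxKV.
have c0 i : c 0 i != 0.
  apply/negP => /eqP ci0.
  (* [f] puts the last form in place of form [i]. If [c 0 i = 0], the row [w] below is a nontrivial
     relation among these [l] forms. *)
  pose f k := if k == i then ord_max else lift ord_max k.
  have injf : injective f.
    move=> k k'; rewrite /f; case: eqP => [->|_]; case: eqP => [->|_] //.
    - by move/eqP; rewrite (negPf (neq_lift _ _)).
    - by move/eqP; rewrite eq_sym (negPf (neq_lift _ _)).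
    - exact: lift_inj.
  pose w : 'rV[K]_l := \row_k if k == i then -1 else c 0 k.
  have w0 : w *m rowsub f A = 0.
    apply/rowP => j; rewrite !mxE (bigD1 i) //= !mxE eqxx /f eqxx.
    have /rowP/(_ j) := cB; rewrite !mxE => <-.
    rewrite (bigD1 i) //= ci0 mul0r add0r mulN1r addrC; apply/eqP.
    rewrite subr_eq0; apply/eqP/eq_bigr => k ki.
    by rewrite !mxE (negPf ki).
  have /row_free_inj injr := indep f injf.
  have : w = 0 by apply: injr; rewrite w0 mul0mx.
  move/rowP/(_ i)/eqP; rewrite !mxE eqxx oppr_eq0.
  by rewrite oner_eq0.
(* [linsubst M] sends [x_i] to [c 0 i] times form [i], and [beta] to the last form. *)
pose M := diag_mx c *m B.
have unitM : M \in unitmx.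
  rewrite unitmx_mul unitB andbT unitmxE det_diag unitfE.
  by apply/prodf_neq0 => i _.
exists M, (invmx M); split; [exact: mulmxV|exact: mulVmx|].
have ME i j : M i j = c 0 i * A (lift ord_max i) j.
  by rewrite /M mul_diag_mx !mxE.
move=> H; rewrite /coordinate_form; case: unliftP => [i ->|->].
  exists (c 0 i)^-1; first by rewrite invr_eq0.
  rewrite linsubstX scaler_sumr; apply: eq_bigr => j _.
  by rewrite scalerA ME mulKf.
exists 1; first exact: oner_neq0.
rewrite scale1r linsubst_sum; under [RHS]eq_bigr do rewrite linsubstX.
rewrite exchange_big; apply: eq_bigr => j _ /=; rewrite -scaler_suml.
congr (_ *: _); have /rowP/(_ j) := cB; rewrite !mxE => <-.
by apply: eq_bigr => i _; rewrite ME; congr (_ * _); rewrite mxE.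
Qed.

Lemma log_coordinateE p j (theta : {ffun 'I_p -> S} -> S) :
  log_coordinate j theta <->
  [/\ is_multider theta, multider_homog j theta &
      forall H, divides_first (coordinate_form H) theta].
Proof.
split=> [[m h x b]|[m h d]]; split=> //.
- move=> H f k k0; rewrite /coordinate_form; case: unlift => [i|]; first exact: x.
  exact: b.
- move=> f k i k0 fk; have := d (lift ord_max i).
  by rewrite /coordinate_form liftK => /(_ f k k0 fk).
- move=> f k k0 fk; have := d ord_max.
  by rewrite /coordinate_form unlift_none => /(_ f k k0 fk).
Qed.

(** Conjugation by the change of coordinates is a linear isomorphism between the two spaces, so it
    carries a basis to a basis. *)
Lemma has_dim_generic A p j d : any_l_independent A ->
  has_dim (@log_coordinate K n p j) d ->
  has_dim (fun theta : {ffun 'I_p -> S} -> S =>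
    log_multider A theta /\ multider_homog j theta) d.
Proof.
move=> /generic_coordinates [M [N [MN NM formE]]] [b [Db freeb spanb]].
have to_coord (theta : {ffun 'I_p -> S} -> S) :
    log_multider A theta -> multider_homog j theta ->
    log_coordinate j (conj_multider M N theta).
  move=> [mt dt] ht; have mc := is_multider_conj MN mt.
  apply/log_coordinateE; split=> //; first exact: multider_homog_conj.
  move=> H; have [a a0 aE] := formE H.
  have -> : coordinate_form H = a^-1 *: linsubst N (linform A H).
    by rewrite aE linearZ /= (linsubstK MN) scalerA mulVf // scale1r.
  by apply: divides_first_scale => //; apply: divides_first_conj => // f k; apply: dt.
have of_coord (theta : {ffun 'I_p -> S} -> S) : log_coordinate j theta ->
    log_multider A (conj_multider N M theta) /\
    multider_homog j (conj_multider N M theta).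
  move=> /log_coordinateE [mt ht dt]; have mc := is_multider_conj NM mt.
  split; last exact: multider_homog_conj.
  split=> // H f k; have [a a0 aE] := formE H.
  suff : divides_first (linform A H) (conj_multider N M theta) by apply.
  by rewrite aE; apply: divides_first_scale => //; apply: divides_first_conj.
exists (fun i => conj_multider N M (b i)); split=> [i|c c0|theta [Lt ht]].
- exact: of_coord.
- apply: freeb => x.
  transitivity (linsubst N (\sum_i c i *: conj_multider N M (b i)
    [ffun k => linsubst M (x k)])); last by rewrite c0 raddf0.
  rewrite linsubst_sum; apply: eq_bigr => i _; rewrite linearZ /=; congr (_ *: _).
  exact/esym/(conj_multiderK MN).
- have [c cE] := spanb _ (to_coord _ Lt ht); exists c => x.
  rewrite -(conj_multiderK NM theta) {1}/conj_multider cE linsubst_sum.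
  by apply: eq_bigr => i _; rewrite linearZ.
Qed.

End GenericArrangement.

(** * Counting the basis elements of [Z_p] *)

Section Counting.
Variables (n N : nat).
Local Notation l := n.+2.
Implicit Types (J : {set 'I_l}).
Local Notation I := ('X_{1..l < N} * {set 'I_l})%type.

Definition closed_count p j := #|@closed_index n p N j|.

(** The exponent of the squarefree monomial with support [J]. *)
Definition mnm_set J : 'X_{1..l} := [multinom (i \in J : nat) | i < l].

Lemma mdeg_mnm_set J : mdeg (mnm_set J) = #|J|.
Proof.
rewrite mdegE -sum1_card [RHS]big_mkcond; apply: eq_bigr => i _.
by rewrite mnmE; case: (i \in J).
Qed.

Lemma mnm_set_le J (u : 'X_{1..l}) :
  [forall i in J, u i != 0%N] = (mnm_set J <= u)%MM.
Proof.
apply/forall_inP/mnm_lepP => [Ju i|le i iJ].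
  by rewrite mnmE; case: (boolP (i \in J)) => // /Ju; rewrite lt0n.
by have := le i; rewrite mnmE iJ lt0n.
Qed.

Definition supported_set p j : {set I} :=
  [set x : I | [&& mdeg x.1 == j, #|x.2| == p & [forall i in x.2, x.1 i != 0%N]]].

Definition degree_set j : {set 'X_{1..l < N}} := [set u : 'X_{1..l < N} | mdeg u == j].

Lemma closed_count0 j : closed_count 0 j = #|degree_set j|.
Proof.
rewrite -[RHS]muln1 -(cards1 (set0 : {set 'I_l})) -cardsX; apply: eq_card => -[u J].
rewrite !inE [in LHS]unfold_in /closed_index /= cards_eq0.
case: (eqVneq J set0) => [->|_]; last by rewrite !andbF.
rewrite inE; congr (_ && _); rewrite andbT.
by apply/forall_inP => i; rewrite inE.
Qed.

Lemma closed_count_top j : closed_count l j = 0%N.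
Proof.
apply: eq_card0 => -[u J]; apply/negP => /and4P [_ /= /eqP Jl _].
suff -> : J = setT by rewrite inE.
by apply/eqP; rewrite eqEcard subsetT cardsT card_ord Jl leqnn.
Qed.

(** Dividing [x^u] by the squarefree monomial of [J] gives a bijection onto pairs of a monomial of
    degree [j - p] and an arbitrary set of size [p]. *)
Lemma card_supported_set p j : (j < N)%N ->
  #|supported_set p j| =
  (if (p <= j)%N then 'C(l, p) * closed_count 0 (j - p) else 0)%N.
Proof.
move=> jN; have [pj|jp] := leqP p j; last first.
  apply: eq_card0 => -[u J]; rewrite inE /= mnm_set_le; apply/and3P => -[].
  move=> /eqP uj /eqP Jp le; move: jp; rewrite ltnNge -uj -Jp -mdeg_mnm_set.
  by rewrite -(submK le) mdegD leq_addl.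
have bnd (x : I) : (mdeg (x.1 - mnm_set x.2)%MM < N)%N.
  exact: leq_ltn_trans (mdegB _ _) (bmdeg _).
pose sh (x : I) : I := (BMultinom (bnd x), x.2).
have shinj : {in supported_set p j &, injective sh}.
  move=> [u J] [u' J']; rewrite !inE /= !mnm_set_le.
  move=> /and3P [_ _ le] /and3P [_ _ le'] e.
  have /= eJ := congr1 snd e; have /= eu := congr1 (fun x => bmnm x.1) e.
  rewrite eJ in le eu *; congr (_, _); apply: val_inj => /=.
  by rewrite -(submK le) eu submK.
have draws : 'C(l, p) = #|[set J : {set 'I_l} | #|J| == p]|.
  by rewrite card_draws card_ord.
rewrite -(card_in_imset shinj) closed_count0 mulnC draws -cardsX.
apply: eq_card => -[u J].
rewrite !inE /=; apply/imsetP/andP => [[[u' J']]|[/eqP uj /eqP Jp]].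
  rewrite inE /= mnm_set_le => /and3P [/eqP uj /eqP Jp le] e.
  have /= -> := congr1 snd e; have /= -> := congr1 (fun x => bmnm x.1) e.
  have := mdegD (u' - mnm_set J')%MM (mnm_set J').
  by rewrite submK // uj mdeg_mnm_set Jp => ->; rewrite addnK !eqxx.
have uN : (mdeg (u + mnm_set J)%MM < N)%N.
  by rewrite mdegD mdeg_mnm_set uj Jp subnK.
exists (BMultinom uN, J).
  rewrite inE /= mnm_set_le lem_addl mdegD mdeg_mnm_set uj Jp subnK //.
  by rewrite !eqxx.
by congr (_, _); apply: val_inj; rewrite /= addmK.
Qed.

(** Sets of size [p.+1] in the support of [u] either avoid [i0], or become sets of size [p] avoiding
    [i0] once [i0] is deleted. In degree 0 the support is empty, and the pair of [0] and the empty
    set accounts for the last term. *)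
Lemma closed_countS p j : (j < N)%N ->
  (closed_count p.+1 j + closed_count p j =
   (if p < j then 'C(l, p.+1) * closed_count 0 (j - p.+1) else 0)
   + ((p == 0) && (j == 0)))%N.
Proof.
move=> jN; have := card_supported_set p.+1 jN => <-.
case: (posnP j) => [j0|jpos].
  rewrite j0 andbT; have z0 q : closed_count q 0 = (q == 0)%N.
    case: q => [|q]; last first.
      apply: eq_card0 => -[u J]; apply/negP => /and4P [/= u0 /eqP Jq /forall_inP Ju _].
      have /card_gt0P [i iJ] : (0 < #|J|)%N by rewrite Jq.
      by have := Ju i iJ; move: u0; rewrite mdeg_eq0 => /eqP ->; rewrite mnm0E.
    rewrite closed_count0; apply/eqP/cards1P.
    have b0 : (mdeg (0%MM : 'X_{1..l}) < N)%N by rewrite mdeg0 -j0.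
    exists (BMultinom b0); apply/setP => u; rewrite !inE mdeg_eq0.
    by rewrite bmeqP.
  rewrite !z0 add0n -j0 card_supported_set // j0; case: ltngtP => //.
(* In positive degree [i0] lies in the support, so it can be added back to [J]. *)
have pos (u : 'X_{1..l < N}) : mdeg u = j -> bmnm u (supp0 u) != 0%N.
  move=> uj; have /existsP [i /supp0P//] : [exists i, bmnm u i != 0%N].
  apply: contraLR jpos => /existsPn u0; rewrite -leqNgt -uj mdegE big1 // => i _.
  by apply/eqP/negPn.
rewrite andbF addn0.
pose Q : {set I} := [set x : I | supp0 x.1 \in x.2].
rewrite -(cardsID Q) addnC; congr (_ + _)%N; last first.
  apply: eq_card => x; rewrite !inE [in LHS]unfold_in /closed_index.
  by rewrite [RHS]andbC -!andbA.
pose del (x : I) : I := (x.1, x.2 :\ supp0 x.1).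
have delinj : {in supported_set p.+1 j :&: Q &, injective del}.
  move=> [u J] [u' J']; rewrite !inE /= => /andP [_ uJ] /andP [_ uJ'] e.
  have /= eu := congr1 fst e; have /= := congr1 snd e.
  by rewrite -eu in uJ' *; rewrite -{2}(setD1K uJ) -{2}(setD1K uJ') => ->.
rewrite -(card_in_imset delinj); apply: eq_card => -[u J].
rewrite [in LHS]unfold_in /closed_index /=; apply/and4P/imsetP.
  move=> [/eqP uj /eqP Jp /forall_inP Ju uJ]; exists (u, supp0 u |: J); last first.
    by rewrite /del /= setU1K.
  rewrite !inE /= eqxx andbT uj cardsU1 uJ Jp !eqxx; apply/forall_inP => i.
  by rewrite !inE => /orP [/eqP ->|/Ju //]; apply: pos.
move=> [[u' J']]; rewrite !inE /= => /andP [/and3P [uj Jp /forall_inP Ju] uJ] e.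
have /= -> := congr1 fst e; have /= -> := congr1 snd e.
split=> //; last by rewrite !inE eqxx.
  by move: Jp; rewrite (cardsD1 (supp0 u')) uJ.
by apply/forall_inP => i; rewrite !inE => /andP [_ /Ju].
Qed.

End Counting.

(** * Congruence of polynomials modulo [x^N] *)

Section Truncation.
Variables (R : comNzRingType) (N : nat).
Implicit Types P Q F : {poly R}.

Definition eq_upto P Q := forall i, (i < N)%N -> P`_i = Q`_i.

Lemma eq_upto_trans Q P F : eq_upto P Q -> eq_upto Q F -> eq_upto P F.
Proof. by move=> PQ QF i iN; rewrite PQ // QF. Qed.

Lemma eq_uptoD P P' Q Q' :
  eq_upto P P' -> eq_upto Q Q' -> eq_upto (P + Q) (P' + Q').
Proof. by move=> PP QQ i iN; rewrite !coefD PP // QQ. Qed.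

Lemma eq_upto_mull F P Q : eq_upto P Q -> eq_upto (F * P) (F * Q).
Proof.
move=> PQ i iN; rewrite !coefM; apply: eq_bigr => k _; rewrite PQ //.
exact: leq_ltn_trans (leq_subr _ _) iN.
Qed.

Lemma eq_upto_sum I (r : seq I) (p : pred I) (F G : I -> {poly R}) :
  (forall i, p i -> eq_upto (F i) (G i)) ->
  eq_upto (\sum_(i <- r | p i) F i) (\sum_(i <- r | p i) G i).
Proof. by move=> FG k kN; rewrite !coef_sum; apply: eq_bigr => i /FG ->. Qed.

End Truncation.

(** * The generating series of the [Z_p] *)

Section GeneratingSeries.
Variables (R : comNzRingType) (N l : nat) (z : nat -> nat -> nat).
Hypothesis ztop : forall j, z l j = 0%N.
Hypothesis zS : forall p j, (j < N)%N ->
  (z p.+1 j + z p j = (if p < j then 'C(l, p.+1) * z 0 (j - p.+1) else 0)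
   + ((p == 0) && (j == 0)))%N.

Definition zpoly p : {poly R} := \poly_(j < N) (z p j)%:R.

Lemma zpolyS p : eq_upto N (zpoly p.+1 + zpoly p)
  ('X^(p.+1) * zpoly 0 *+ 'C(l, p.+1) + (p == 0%N)%:R).
Proof.
move=> j jN.
have E : ((p == 0%N)%:R : {poly R})`_j = ((p == 0%N) && (j == 0%N))%:R.
  by rewrite -polyC_natr coefC; case: (j == 0%N); rewrite ?andbT ?andbF.
rewrite [RHS]coefD E !(coefD, coefMn, coefXnM, coef_poly) jN -natrD zS // natrD ltnS.
congr (_ + _); case: (ltnP p j) => pj; last by rewrite mul0rn.
by rewrite (leq_ltn_trans (leq_subr _ _) jN) natrM mulr_natl.
Qed.

Lemma zpoly_top : zpoly l = 0.
Proof. by apply/polyP => j; rewrite coef_poly ztop coef0 if_same. Qed.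

(** As [zpoly l = 0], the product regroups into [zpoly 0] plus the sum of the
    [w^(p+1) (zpoly p.+1 + zpoly p)], and the recurrence makes this a binomial expansion. The
    correction at [p = 0] yields the term [w], present only if the sum is nonempty. *)
Lemma zpoly_series (w : {poly R}) :
  eq_upto N ((1 + w) * \sum_(p < l) zpoly p * w ^+ p)
    (w *+ (0 < l)%N + (1 + 'X * w) ^+ l * zpoly 0).
Proof.
have -> : (1 + w) * \sum_(p < l) zpoly p * w ^+ p =
    zpoly 0 + \sum_(p < l) w ^+ p.+1 * (zpoly p.+1 + zpoly p).
  transitivity (\sum_(p < l.+1) zpoly p * w ^+ p +
                w * \sum_(p < l) zpoly p * w ^+ p).
    by rewrite big_ord_recr /= zpoly_top mul0r addr0 mulrDl mul1r.
  rewrite big_ord_recl expr0 mulr1 -addrA mulr_sumr -big_split /=.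
  by congr (_ + _); apply: eq_bigr => p _ /=; rewrite /bump add1n exprS; ring.
have -> : w *+ (0 < l)%N + (1 + 'X * w) ^+ l * zpoly 0 =
    zpoly 0 + \sum_(p < l) w ^+ p.+1 *
      ('X^(p.+1) * zpoly 0 *+ 'C(l, p.+1) + (p == 0%N :> nat)%:R).
  rewrite exprDn big_ord_recl subn0 expr1n expr0 mul1r bin0 mulr1n mulrDl mul1r.
  rewrite addrCA; congr (_ + _).
  under [X in _ = X]eq_bigr do rewrite mulrDr.
  rewrite big_split addrC mulr_suml; congr (_ + _).
    apply: eq_bigr => p _ /=; rewrite /bump add1n expr1n mul1r exprMn.
    by rewrite mulrnAl mulrnAr; congr (_ *+ _); ring.
  case: (l) => [|l']; first by rewrite big_ord0.
  rewrite big_ord_recl big1 => [|p _]; last by rewrite /= mulr0.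
  by rewrite /= mulr1 addr0 expr1.
apply: eq_uptoD => //; apply: eq_upto_sum => p _.
exact/eq_upto_mull/zpolyS.
Qed.

(* At [w = -1] the left-hand side of [zpoly_series] vanishes. *)
Lemma zpoly0_inverse : (0 < l)%N -> eq_upto N ((1 - 'X) ^+ l * zpoly 0) 1.
Proof.
move=> l0 i iN; have := zpoly_series (-1) iN.
rewrite l0 mulr1n subrr mul0r coef0 coefD mulrN1 coefN => /esym/eqP.
by rewrite addrC subr_eq0 => /eqP.
Qed.

End GeneratingSeries.

(** * From the generating series to the closed form *)

Lemma fps_mul_coef (R : nzRingType) (F : nat -> R) (P Q : {poly R}) m :
  (forall i, (i < m.+1)%N -> F i = P`_i) ->
  fps_mul F (fps_of_poly Q) m = (P * Q)`_m.
Proof. by move=> FP; rewrite coefM; apply: eq_bigr => i _; rewrite FP. Qed.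

(** The Hilbert series of [D^p] has the shape [z p + x * z (p - 1)]; reindexing the second part
    pulls out a factor [x * w]. *)
Lemma shifted_sum (R : comNzRingType) (l : nat) (z : nat -> R) (x w : R) :
  z l = 0 ->
  \sum_(p < l.+1) (z p + x * if nat_of_ord p is q.+1 then z q else 0) * w ^+ p =
  (1 + x * w) * \sum_(p < l) z p * w ^+ p.
Proof.
move=> zl0; under eq_bigr do rewrite mulrDl.
rewrite big_split big_ord_recr /= zl0 mul0r addr0 mulrDl mul1r; congr (_ + _).
rewrite big_ord_recl mulr0 mul0r add0r mulr_sumr; apply: eq_bigr => p _ /=.
by rewrite /bump add1n exprS; ring.
Qed.

Section ClosedForm.
Local Notation R := {poly {poly int}}.

(** As a series in [x], [x - 1] has constant term [-1], and [t] is not a zero divisor, so the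
    coefficients of [D] vanish one after the other. *)
Lemma eq_upto_cancel N (D : R) :
  eq_upto N (tvar * (xvar - 1) * D) 0 -> eq_upto N D 0.
Proof.
move=> D0; elim=> [|i IH] iN; have := D0 _ iN;
  rewrite -mulrA coefCM coef0 => /eqP; rewrite mulf_eq0 polyX_eq0 /=;
  rewrite mulrBl mul1r coefB /xvar coefXM /= ?(IH (ltnW iN)) ?coef0 sub0r oppr_eq0;
  exact: eqP.
Qed.

(* Multiplying by [t] turns the sum into a binomial expansion of
   [(1 - t x)^(l+1)]. *)
Lemma tvar_closed_form (l : nat) : (1 < l)%N ->
  tvar * ((1 + (l%:R - 1) * xvar)
     - tvar * (xvar + ('C(l.+1, 2)%:R - 1) * xvar ^+ 2)
     + \sum_(2 <= i < l.+1)
         (-1) ^+ i * 'C(l.+1, i.+1)%:R * xvar ^+ i.+1 * tvar ^+ i) =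
  - (1 - tvar * xvar) *
    (tvar * (xvar - 1) - 1 + (1 - tvar * xvar) ^+ l) :> R.
Proof.
case: l => // l _; set y : R := tvar * xvar.
set s := \sum_(2 <= i < _) _.
(* The terms of index 0, 1 and 2 are split off; those from index 3 on form [- t s] after a shift by
   one. *)
have binE : (1 - y) ^+ l.+2 =
    1 - y *+ l.+2 + y ^+ 2 *+ 'C(l.+2, 2) - tvar * s.
  rewrite exprDn -(big_mkord xpredT
    (fun i => 1 ^+ (l.+2 - i) * (- y) ^+ i *+ 'C(l.+2, i))).
  rewrite big_nat_recl // big_nat_recl // big_nat_recl //.
  rewrite !expr1n !mul1r bin0 bin1 expr0 expr1 mulr1n mulNrn sqrrN -!addrA.
  congr (_ + (_ + (_ + _))); rewrite /s mulr_sumr -sumrN.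
  rewrite [RHS]big_add1 [RHS]big_add1 /=; apply: eq_bigr => i _.
  rewrite expr1n mul1r -[_ *+ 'C(_, _)]mulr_natr [in LHS]exprNn /y exprMn.
  by rewrite [in LHS]exprS [tvar ^+ _ in LHS]exprS; ring.
transitivity (- (1 - y) ^+ l.+2 - (1 - y) * (y - tvar - 1)); last first.
  by rewrite [in LHS]exprS /y; ring.
rewrite binE /y -[_ *+ l.+2]mulr_natr -[_ *+ 'C(_, _)]mulr_natr -[in RHS]natr1.
by ring.
Qed.

End ClosedForm.

(** * Assembling the formula *)

Lemma Hilb_generic (K : fieldType) (n N : nat) (A : 'M[K]_(n.+3, n.+2)) p j :
  any_l_independent A -> (j < N)%N ->
  Hilb A p j = (zpoly {poly int} N (closed_count n N) p +
    'X * if p is q.+1 then zpoly _ N (closed_count n N) q else 0)`_j.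
Proof.
move=> indep jN; rewrite coefD coefXM coef_poly jN /Hilb.
case: p => [|p].
  rewrite coef0 if_same addr0; congr (_%:R).
  exact/dimension_eq/has_dim_generic/has_dim_log_coordinate0.
(* The wedge part is the basis of the preceding [Z_p] shifted by the degree 1 of the Euler
   derivation; it is empty for [j = 0]. *)
rewrite (dimension_eq (has_dim_generic indep (has_dim_log_coordinate K n p jN))).
rewrite natrD; congr (_ + _); case: j jN => [|j] jN /=.
  by rewrite (_ : #|_| = 0%N) //; apply: eq_card0.
rewrite coef_poly ltnW //; congr (_%:R); exact: eq_card.
Qed.

(** For [l = 0] a row has no entries and cannot be nonzero; for [l = 1] both hyperplanes are the
    origin, so they are not distinct. *)
Lemma generic_gt1 (K : fieldType) (l : nat) (A : 'M[K]_(l.+1, l)) :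
  is_arrangement A -> (1 < l)%N.
Proof.
case: l A => [|[|l]] A [row0 inj] //.
  by have := row0 ord0; rewrite thinmx0 eqxx.
have hypE i v : hyperplane A i v = (v == 0).
  have Ai : A i 0 != 0.
    apply: contraNneq (row0 i) => Ai0; apply/eqP/rowP => k.
    by rewrite !mxE (ord1 k).
  rewrite /hyperplane /=; apply/eqP/eqP => [|->]; last exact: mulmx0.
  move/matrixP/(_ 0 0)/eqP; rewrite !mxE big_ord1 !mxE mulf_eq0 (negPf Ai) /=.
  by move=> /eqP v0; apply/colP => k; rewrite mxE (ord1 k).
by have /(congr1 val) := inj ord0 ord_max (fun v => etrans (hypE _ v) (esym (hypE _ v))).
Qed.

Theorem theorem6p6 (K : fieldType) (l : nat) (A : 'M[K]_(l.+1, l))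
    (hA : generic_arrangement A) :
  Psi A =1 fps_of_poly
    ((1 + (l%:R - 1) * xvar)
     - tvar * (xvar + ('C(l.+1, 2)%:R - 1) * xvar ^+ 2)
     + \sum_(2 <= i < l.+1)
         (-1) ^+ i * 'C(l.+1, i.+1)%:R * xvar ^+ i.+1 * tvar ^+ i).
Proof.
move=> m; have [arr indep] := hA; have := generic_gt1 arr.
case: l A hA arr indep => [|[|n]] // A _ _ indep l1.
set Q := (X in fps_of_poly X).
have tQ := tvar_closed_form l1; rewrite -/Q in tQ.
set w := tvar * (xvar - 1) - 1.
(* Coefficient [m] involves only degrees up to [m], so the computation takes place modulo
   [x^(m+1)]. *)
pose N := m.+1; pose z := zpoly {poly int} N (closed_count n N).
have ztop : z n.+2 = 0 by apply/zpoly_top/closed_count_top.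
pose T := \sum_(p < n.+2) z p * w ^+ p.
have series v : eq_upto N ((1 + v) * \sum_(p < n.+2) z p * v ^+ p)
    (v + (1 + 'X * v) ^+ n.+2 * z 0%N).
  apply: (@zpoly_series _ N n.+2 (closed_count n N)).
    exact: closed_count_top.
  exact: closed_countS.
have PsiE : Psi A m = ((1 + xvar * w) * T)`_m.
  rewrite /Psi; transitivity ((\sum_(p < n.+3) (z p +
      'X * if nat_of_ord p is q.+1 then z q else 0) * w ^+ p)`_m).
    rewrite coef_sum; apply: eq_bigr => p _; apply: fps_mul_coef => i im.
    exact: Hilb_generic.
  by rewrite shifted_sum.
have unit_series : eq_upto N ((1 - 'X) ^+ n.+2 * z 0%N) 1.
  apply: (@zpoly0_inverse _ N n.+2 (closed_count n N)) => //.
    exact: closed_count_top.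
  exact: closed_countS.
suff : eq_upto N ((1 + xvar * w) * T - Q) 0.
  move=> /(_ m (ltnSn m)); rewrite coefB coef0 PsiE /fps_of_poly => /eqP.
  by rewrite subr_eq0 => /eqP.
apply: eq_upto_cancel.
(* Here [t (x - 1) = 1 + w], which brings out the left-hand side of [series w]. *)
have -> : tvar * (xvar - 1) * ((1 + xvar * w) * T - Q) =
    (1 + xvar * w) * ((1 + w) * T) + (1 - xvar) * (tvar * Q).
  by rewrite /w; ring.
rewrite tQ -/w; set y := 1 - tvar * xvar.
have xw : 1 + xvar * w = y * (1 - 'X) by rewrite /w /y /xvar; ring.
(* Zero is written in the same shape, so that the second summands agree and the first ones remain to
   be compared. *)
have -> : 0 = (1 + xvar * w) * (w + y ^+ n.+2) +
    (1 - xvar) * (- y * (w + y ^+ n.+2)) :> {poly {poly int}}.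
  by rewrite xw /xvar; ring.
apply: eq_uptoD => //; apply: eq_upto_mull.
(* By [xw], [(1 + x w)^l] contains the factor [(1 - x)^l], which cancels against [z 0]. *)
apply: eq_upto_trans (series w) _; apply: eq_uptoD => //.
rewrite -/xvar xw exprMn -mulrA -[X in eq_upto _ _ X]mulr1.
exact: eq_upto_mull.
Qed.
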